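(* Let $f:\mathbb{R}^d\to\mathbb{R}$ satisfy the Standing Assumptions with constants $0<\mu\le L$ and $M>0$, and let $\{x_t\}$ be generated by General Sharpened-BFGS from an initial point $x_0$ with $$\lambda_0\le\frac{C_1\mu}{dML},\qquad C_1=\frac{\ln2}{20},$$ assuming $\nabla f(x_t)\ne0$ for all $t$ considered. Then for all $t\ge1$, $$\lambda_t\le 2\left(1-\frac{\mu}{2dL}\right)^{\frac{t(t-1)}{4}}\left(\frac{8dL}{t\mu}\right)^{\frac t2}\lambda_0,$$ where $\lambda_t:=\lambda_f(x_t)$.
   Context: Standing Assumptions: $f$ is twice differentiable, $\mu$-strongly convex and has $L$-Lipschitz gradient, and is strongly self-concordant with constant $M>0$: for all $x,y,z,w\in\mathbb{R}^d$, $\nabla^2f(y)-\nabla^2f(x)\preceq M\|y-x\|_z\nabla^2f(w)$, where $\|h\|_z:=\sqrt{h^\top\nabla^2f(z)h}$. Newton decrement: $\lambda_f(x):=\sqrt{\nabla f(x)^\top\nabla^2f(x)^{-1}\nabla f(x)}$. For symmetric positive definite $A,G$ and $u\ne0$, $\mathrm{BFGS}(A,G,u):=G-\frac{Guu^\top G}{u^\top Gu}+\frac{Auu^\top A}{u^\top Au}$, and $\bar u(A,G):=\arg\max_{u\in\{e_1,\dots,e_d\}}\frac{u^\top Gu}{u^\top Au}$ (ties broken arbitrarily). General Sharpened-BFGS: set $G_0=LI$; for $t=0,1,2,\dots$: $x_{t+1}=x_t-G_t^{-1}\nabla f(x_t)$; $s_t=x_{t+1}-x_t$; $J_t=\int_0^1\nabla^2f(x_t+\tau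 s_t)\,d\tau$; $\bar G_t=\mathrm{BFGS}(J_t,G_t,s_t)$; $r_t=\|s_t\|_{x_t}$; $\hat G_t=(1+Mr_t/2)^2\bar G_t$; $\bar u=\bar u(\nabla^2f(x_{t+1}),\hat G_t)$; $G_{t+1}=\mathrm{BFGS}(\nabla^2f(x_{t+1}),\hat G_t,\bar u)$. *)

(* Defs.v *)
From HB Require Import structures.
From mathcomp Require Import all_boot all_order all_algebra.
From mathcomp Require Import all_classical all_reals all_analysis.
Set Implicit Arguments. Unset Strict Implicit. Unset Printing Implicit Defensive.
Import Order.TTheory GRing.Theory Num.Theory.
Import numFieldNormedType.Exports.
Local Open Scope classical_set_scope.
Local Open Scope ring_scope.

Section Defs.
Variables (R : realType) (d : nat).
Notation vec := 'cV[R]_d.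
Notation mat := 'M[R]_d.

Definition dotv (u v : vec) : R := (u^T *m v) 0 0.
Definition norm2 (u : vec) : R := Num.sqrt (dotv u u).
Definition qform (A : mat) (u : vec) : R := dotv u (A *m u).
Definition loewner_le (A B : mat) : Prop := forall u : vec, qform A u <= qform B u.
Definition lnorm (H : vec -> mat) (z h : vec) : R := Num.sqrt (qform (H z) h).
Definition newton_decr (g : vec -> vec) (H : vec -> mat) (x : vec) : R :=
  Num.sqrt (dotv (g x) (invmx (H x) *m g x)).

Definition bfgs (A G : mat) (u : vec) : mat :=
  G - (qform G u)^-1 *: (G *m u *m u^T *m G)
    + (qform A u)^-1 *: (A *m u *m u^T *m A).

Definition ebasis (i : 'I_d) : vec := delta_mx i 0.

Definition is_greedy_dir (A G : mat) (u : vec) : Prop :=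
  (exists i : 'I_d, u = ebasis i) /\
  forall j : 'I_d, qform G (ebasis j) / qform A (ebasis j) <= qform G u / qform A u.

Definition avg_hessian (H : vec -> mat) (x s : vec) : mat :=
  \matrix_(i, j) Rintegral (@lebesgue_measure R) `[0%R, 1%R]
     (fun tau : R => H (x + tau *: s) i j).

End Defs.

Definition standing_assumptions (R : realType) (d : nat)
  (f : 'cV[R]_d -> R) (g : 'cV[R]_d -> 'cV[R]_d) (H : 'cV[R]_d -> 'M[R]_d)
  (mu L M : R) : Prop :=
  (forall x, differentiable f x /\ forall v, 'd f x v = dotv (g x) v) /\
  (forall x, differentiable g x /\ forall v, 'd g x v = H x *m v) /\
  (forall x y, f x + dotv (g x) (y - x) + mu / 2 * (norm2 (y - x)) ^+ 2 <= f y) /\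
  (forall x y, norm2 (g x - g y) <= L * norm2 (x - y)) /\
  (forall x y z w, loewner_le (H y - H x) ((M * lnorm H z (y - x)) *: H w)).

(* General Sharpened-BFGS iterates (x_t, G_t); the greedy direction is any
   maximizer (ties broken arbitrarily). *)
Definition sharpened_bfgs (R : realType) (d : nat)
  (g : 'cV[R]_d -> 'cV[R]_d) (H : 'cV[R]_d -> 'M[R]_d) (L M : R)
  (x : nat -> 'cV[R]_d) (G : nat -> 'M[R]_d) : Prop :=
  G 0%N = L%:M /\
  forall t : nat,
    let s := x t.+1 - x t in
    let J := avg_hessian H (x t) s in
    let Gbar := bfgs J (G t) s in
    let r := lnorm H (x t) s in
    let Ghat := (1 + M * r / 2) ^+ 2 *: Gbar in
    x t.+1 = x t - invmx (G t) *m g (x t) /\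
    exists u, is_greedy_dir (H (x t.+1)) Ghat u /\
              G t.+1 = bfgs (H (x t.+1)) Ghat u.

(* Main.v *)
(** The step s_t satisfies G_t s_t = - g_t and J_t s_t = g_{t+1} - g_t, so
    theta_t^2 := |g_{t+1}|^2_{J_t^-1} / |g_t|^2_{J_t^-1} measures how well G_t
    approximates J_t along s_t, and lambda_{t+1} <= c_t theta_t lambda_t with
    c_t = 1 + M r_t / 2.  The invariant is H_t <= G_t, and the potential is
    sigma_t = tr (H_t^-1 G_t) - d: the BFGS update along s_t decreases it by
    theta_t^2 up to an O(r_t) term, and the greedy update multiplies it by
    1 - kappa, kappa = mu / (d L).  Since G_t <= tr (H_t^-1 G_t) H_t, a bounded
    potential gives theta_t <= 1 - (81/100) kappa, so lambda_t decays linearly and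
    the error terms are summable.  Hence, with w = 1 - kappa / 2, the sum of the
    w^-i theta_i^2 is at most 2 / kappa, and AM-GM bounds the product of the
    theta_i. *)

Require Import Defs.
From HB Require Import structures.
From mathcomp Require Import all_boot all_order all_algebra.
From mathcomp Require Import all_classical all_reals all_analysis.
From mathcomp Require Import ring lra.
Set Implicit Arguments. Unset Strict Implicit. Unset Printing Implicit Defensive.
Import Order.TTheory GRing.Theory Num.Theory.
Import numFieldNormedType.Exports.
Local Open Scope ring_scope.

(** * Quadratic forms, traces and the BFGS update *)

Section BilinearForms.
Variable R : realType.

Definition bform d (A : 'M[R]_d) (u v : 'cV[R]_d) : R := dotv u (A *m v).
Definition psd d (A : 'M[R]_d) := A^T = A /\ forall u, 0 <= qform A u.
Definition posdef d (A : 'M[R]_d) := A^T = A /\ forall u, u != 0 -> 0 < qform A u.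

Variable d : nat.
Implicit Types (A B D G N X Y : 'M[R]_d) (u v w : 'cV[R]_d) (a b c : R).

Lemma dotvE u v : dotv u v = \sum_i u i 0 * v i 0.
Proof. by rewrite /dotv mxE; apply: eq_bigr => i _; rewrite mxE. Qed.

Lemma dotvC u v : dotv u v = dotv v u.
Proof. by rewrite !dotvE; apply: eq_bigr => i _; rewrite mulrC. Qed.

Lemma dotvDr u v w : dotv u (v + w) = dotv u v + dotv u w.
Proof. by rewrite /dotv mulmxDr mxE. Qed.

Lemma dotvZr a u v : dotv u (a *: v) = a * dotv u v.
Proof. by rewrite /dotv -scalemxAr mxE. Qed.

Lemma dotvNr u v : dotv u (- v) = - dotv u v.
Proof. by rewrite -scaleN1r dotvZr mulN1r. Qed.

Lemma dotvDl u v w : dotv (v + w) u = dotv v u + dotv w u.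
Proof. by rewrite !(dotvC _ u) dotvDr. Qed.

Lemma dotvZl a u v : dotv (a *: u) v = a * dotv u v.
Proof. by rewrite !(dotvC _ v) dotvZr. Qed.

Lemma dotvNl u v : dotv (- u) v = - dotv u v.
Proof. by rewrite !(dotvC _ v) dotvNr. Qed.

Lemma dotvBl u v w : dotv (v - w) u = dotv v u - dotv w u.
Proof. by rewrite dotvDl dotvNl. Qed.

Lemma dotv_mull A u v : dotv (A *m u) v = dotv u (A^T *m v).
Proof. by rewrite /dotv trmx_mul mulmxA. Qed.

Lemma dotv_ge0 u : 0 <= dotv u u.
Proof. by rewrite dotvE sumr_ge0 // => i _; rewrite -expr2 sqr_ge0. Qed.

Lemma dotv_eq0 u : (dotv u u == 0) = (u == 0).
Proof.
apply/idP/eqP => [|->]; last by rewrite -(scale0r 0) dotvZr mul0r eqxx.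
rewrite dotvE psumr_eq0; last by move=> i _; rewrite -expr2 sqr_ge0.
move=> /allP u0; apply/matrixP => i j; rewrite ord1 mxE.
by have := u0 i (mem_index_enum _); rewrite mulf_eq0 orbb => /eqP.
Qed.

Lemma dotv_gt0 u : u != 0 -> 0 < dotv u u.
Proof. by move=> u0; rewrite lt_def dotv_eq0 u0 dotv_ge0. Qed.

Lemma norm2_sqr u : norm2 u ^+ 2 = dotv u u.
Proof. by rewrite /norm2 sqr_sqrtr ?dotv_ge0. Qed.

Lemma qformE A u : qform A u = bform A u u. Proof. by []. Qed.

Lemma bformDr A u v w : bform A u (v + w) = bform A u v + bform A u w.
Proof. by rewrite /bform mulmxDr dotvDr. Qed.

Lemma bformZr A a u v : bform A u (a *: v) = a * bform A u v.
Proof. by rewrite /bform -scalemxAr dotvZr. Qed.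

Lemma bformDl A u v w : bform A (v + w) u = bform A v u + bform A w u.
Proof. by rewrite /bform dotvDl. Qed.

Lemma bformZl A a u v : bform A (a *: u) v = a * bform A u v.
Proof. by rewrite /bform dotvZl. Qed.

Lemma bformNr A u v : bform A u (- v) = - bform A u v.
Proof. by rewrite -scaleN1r bformZr mulN1r. Qed.

Lemma bformNl A u v : bform A (- u) v = - bform A u v.
Proof. by rewrite -scaleN1r bformZl mulN1r. Qed.

Lemma bformC A u v : A^T = A -> bform A u v = bform A v u.
Proof. by move=> sA; rewrite /bform dotvC dotv_mull sA. Qed.

Lemma bform_addm A B u v : bform (A + B) u v = bform A u v + bform B u v.
Proof. by rewrite /bform mulmxDl dotvDr. Qed.

Lemma bform_scalem a A u v : bform (a *: A) u v = a * bform A u v.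
Proof. by rewrite /bform -scalemxAl dotvZr. Qed.

Lemma bform_oppm A u v : bform (- A) u v = - bform A u v.
Proof. by rewrite -scaleN1r bform_scalem mulN1r. Qed.

Lemma bform_subm A B u v : bform (A - B) u v = bform A u v - bform B u v.
Proof. by rewrite bform_addm bform_oppm. Qed.

Definition bformm := (bform_addm, bform_scalem, bform_oppm).
Definition bformv := (bformDl, bformDr, bformZl, bformZr, bformNl, bformNr).

Lemma qform_scalem a A u : qform (a *: A) u = a * qform A u.
Proof. exact: bform_scalem. Qed.

Lemma bform1 u v : bform 1%:M u v = dotv u v.
Proof. by rewrite /bform mul1mx. Qed.

Lemma qform0 A : qform A 0 = 0.
Proof. by rewrite qformE -(scale0r 0) bformZl mul0r. Qed.

Lemma bform_row_col u v w w' : bform (u *m v^T) w w' = dotv w u * dotv v w'.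
Proof.
by rewrite /bform /dotv -!mulmxA mulmxA [RHS]mulrC mxE big_ord1 mulrC.
Qed.

Lemma posdef_psd A : posdef A -> psd A.
Proof.
case=> sA pA; split=> // u; have [->|u0] := eqVneq u 0; first by rewrite qform0.
exact/ltW/pA.
Qed.

Lemma posdef_unit A : posdef A -> A \in unitmx.
Proof.
case=> sA pA; rewrite unitmxE unitfE; apply/negP => /det0P[v v0 vA].
have /pA : v^T != 0 by apply: contraNneq v0 => v0; rewrite -(trmxK v) v0 trmx0.
by rewrite /qform /dotv trmxK mulmxA vA mul0mx mxE ltxx.
Qed.

Lemma posdef_scale a A : 0 < a -> posdef A -> posdef (a *: A).
Proof.
move=> a0 [sA pA]; split; first by rewrite linearZ /= sA.
by move=> u u0; rewrite qform_scalem mulr_gt0 ?pA.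
Qed.

Lemma invmx_sym A : A^T = A -> (invmx A)^T = invmx A.
Proof. by move=> sA; rewrite trmx_inv sA. Qed.

Lemma mulmxVv A u : posdef A -> A *m (invmx A *m u) = u.
Proof. by move=> /posdef_unit Au; rewrite mulmxA mulmxV // mul1mx. Qed.

Lemma mulVmxv A u : posdef A -> invmx A *m (A *m u) = u.
Proof. by move=> /posdef_unit Au; rewrite mulmxA mulVmx // mul1mx. Qed.

Lemma qform_inv A u : posdef A -> qform (invmx A) u = qform A (invmx A *m u).
Proof. by move=> pA; rewrite /qform mulmxVv // dotvC. Qed.

Lemma qform_inv_mul A u : posdef A -> qform (invmx A) (A *m u) = qform A u.
Proof. by move=> pA; rewrite /qform mulVmxv // dotvC. Qed.

Lemma posdef_inv A : posdef A -> posdef (invmx A).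
Proof.
move=> pA; split; first by apply: invmx_sym; case: pA.
move=> u u0; rewrite qform_inv //; apply: (proj2 pA).
by apply: contraNneq u0 => u0; rewrite -(mulmxVv u pA) u0 mulmx0.
Qed.

Lemma posdef_loewner A B c : 0 < c -> posdef A -> B^T = B ->
  loewner_le A (c *: B) -> posdef B.
Proof.
move=> c0 [sA pA] sB AB; split=> // u u0.
by have := lt_le_trans (pA u u0) (AB u); rewrite qform_scalem pmulr_rgt0.
Qed.

(** The polynomial [qform A (u + t *: v)] in t is nonnegative; evaluate it at its minimizer, or, if
    its quadratic term vanishes, far enough along its slope. *)
Lemma bform_cauchy A u v : psd A -> bform A u v ^+ 2 <= qform A u * qform A v.
Proof.
case=> sA pA.
have H t : 0 <= qform A u + 2 * t * bform A u v + t ^+ 2 * qform A v.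
  have := pA (u + t *: v).
  by rewrite !qformE !bformv (bformC v u sA); congr (_ <= _); ring.
have [v0|v0] := eqVneq (qform A v) 0.
  have [->|c0] := eqVneq (bform A u v) 0; first by rewrite expr0n v0 mulr0.
  (* The polynomial is affine with nonzero slope here, and at this t its value is -1. *)
  have := H (- (qform A u + 1) / (2 * bform A u v)).
  rewrite v0; have -> : qform A u
    + 2 * (- (qform A u + 1) / (2 * bform A u v)) * bform A u v
    + (- (qform A u + 1) / (2 * bform A u v)) ^+ 2 * 0 = -1 by field.
  by rewrite oppr_ge0 ler10.
have vp : 0 < qform A v by rewrite lt_def v0 pA.
have := H (- bform A u v / qform A v); have -> : qform A u
    + 2 * (- bform A u v / qform A v) * bform A u v
    + (- bform A u v / qform A v) ^+ 2 * qform A v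
    = qform A u - bform A u v ^+ 2 / qform A v by field.
by rewrite subr_ge0 ler_pdivrMr.
Qed.

(** Cauchy-Schwarz for [A] at v and A^-1 u: the norms given by [A] and by its inverse are dual. *)
Lemma dotv_cauchy_inv A u v : posdef A ->
  dotv v u ^+ 2 <= qform A v * qform (invmx A) u.
Proof.
move=> pA; have := bform_cauchy v (invmx A *m u) (posdef_psd pA).
by rewrite /bform mulmxVv // -qform_inv.
Qed.

(** Put w = A^-1 u, so that w . u is both |w|^2_A and |u|^2_{A^-1}. Duality gives (w . u)^2 <=
    |w|^2_B |u|^2_{B^-1} <= c |w|^2_A |u|^2_{B^-1}; divide by w . u. *)
Lemma loewner_inv A B c : posdef A -> posdef B -> loewner_le B (c *: A) ->
  loewner_le (invmx A) (c *: invmx B).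
Proof.
move=> pA pB BA u; rewrite qform_scalem.
have [->|u0] := eqVneq u 0; first by rewrite !qform0 mulr0.
have ap := proj2 (posdef_inv pA) _ u0; have bp := proj2 (posdef_inv pB) _ u0.
have := dotv_cauchy_inv u (invmx A *m u) pB; have := BA (invmx A *m u).
rewrite qform_scalem -qform_inv // [dotv _ u]dotvC -/(qform _ u) => h1 h2.
rewrite -(ler_pM2l ap) -expr2 (le_trans h2) // mulrA [_ * c]mulrC.
by rewrite ler_pM2r.
Qed.

Lemma bform_ebasisr A i u : bform A u (ebasis R i) = (A^T *m u) i 0.
Proof.
rewrite /bform -[A]trmxK -dotv_mull dotvE (bigD1 i) //= big1 => [|j ji].
  by rewrite /ebasis [delta_mx _ _ _ _]mxE !eqxx mulr1 addr0 trmxK.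
by rewrite /ebasis [delta_mx _ _ _ _]mxE (negPf ji) mulr0.
Qed.

Lemma dotv_ebasis u i : dotv u (ebasis R i) = u i 0.
Proof. by rewrite -bform1 bform_ebasisr trmx1 mul1mx. Qed.

Lemma ebasis_neq0 (i : 'I_d) : ebasis R i != 0.
Proof.
apply/eqP => /matrixP/(_ i 0); rewrite !mxE !eqxx => /eqP.
by rewrite oner_eq0.
Qed.

Lemma bform_ebasis A i j : bform A (ebasis R i) (ebasis R j) = A i j.
Proof. by rewrite bform_ebasisr /ebasis -colE !mxE. Qed.

Lemma qform_ebasis A i : qform A (ebasis R i) = A i i.
Proof. exact: bform_ebasis. Qed.

Lemma mxtrace_rank1 u Y : \tr (u *m u^T *m Y) = qform Y u.
Proof. by rewrite -mulmxA mxtrace_mulC /qform /dotv /mxtrace big_ord1 -mulmxA. Qed.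

(* X is peeled off one rank-one term X e_i e_i^T X / X_ii at a time; each step
   creates a new zero on the diagonal. *)
Lemma mxtrace_psd_mul_ge0 X Y : psd X -> psd Y -> 0 <= \tr (X *m Y).
Proof.
move=> pX [sY pY].
have [n] := ubnP #|[pred i | qform X (ebasis R i) != 0]|.
elim: n X pX => // n IH X [sX pX] leXn.
have [i /= Xi0|X0] := pickP [pred i | qform X (ebasis R i) != 0]; last first.
  (* By Cauchy-Schwarz each squared entry is at most a product of two diagonal entries, all of which
     vanish in this case. *)
  suff -> : X = 0 by rewrite mul0mx mxtrace0.
  apply/matrixP => i j; rewrite mxE.
  have := bform_cauchy (ebasis R j) (ebasis R i) (conj sX pX).
  have /negbFE/eqP -> := X0 i.
  rewrite mulr0 bform_ebasisr sX /ebasis -colE mxE => h.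
  by apply/eqP; rewrite -sqrf_eq0 eq_le h sqr_ge0.
set e := ebasis R i in Xi0 *; set a := qform X e in Xi0 *.
have a0 : 0 < a by rewrite lt_def Xi0 pX.
pose X' := X - a^-1 *: ((X *m e) *m (X *m e)^T).
have X'E u : qform X' u = qform X u - (bform X u e) ^+ 2 / a.
  rewrite /X' qformE !bformm bform_row_col.
  by rewrite [dotv (X *m e) u]dotvC -/(bform X u e) qformE; congr (_ - _); ring.
have pX' : psd X'.
  split=> [|u].
    by rewrite /X' linearB linearZ /= sX trmx_mul trmxK.
  by rewrite X'E subr_ge0 ler_pdivrMr // bform_cauchy.
have -> : X = X' + a^-1 *: ((X *m e) *m (X *m e)^T) by rewrite subrK.
rewrite mulmxDl mxtraceD addr_ge0 //; last first.
  by rewrite -scalemxAl mxtraceZ mxtrace_rank1 mulr_ge0 // invr_ge0 ltW.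
apply: (IH _ (pX')); rewrite -ltnS (leq_trans _ leXn) // ltnS proper_card //.
apply/fintype.properP; split.
  apply/fintype.subsetP => j; rewrite !inE; apply: contra_neq => Xj0.
  apply/eqP; rewrite eq_le (proj2 pX') andbT X'E Xj0 sub0r oppr_le0.
  by rewrite divr_ge0 ?sqr_ge0 // ltW.
exists i; rewrite inE // X'E -/e -qformE -/a negbK; apply/eqP.
by field.
Qed.

Lemma mxtrace_loewner X1 X2 Y : X1^T = X1 -> X2^T = X2 -> loewner_le X1 X2 ->
  psd Y -> \tr (X1 *m Y) <= \tr (X2 *m Y).
Proof.
move=> s1 s2 X12 pY; rewrite -subr_ge0 -[_ - _]raddfB /= -mulmxBl.
apply: mxtrace_psd_mul_ge0 pY; split=> [|u]; first by rewrite linearB /= s1 s2.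
by rewrite qformE bform_subm subr_ge0 X12.
Qed.

(** Duality says u u^T <= |u|^2_H H^-1 in the Loewner order; taking the trace against [G] turns the
    left side into |u|^2_G. *)
Lemma loewner_trace G H : psd G -> posdef H ->
  loewner_le G (\tr (invmx H *m G) *: H).
Proof.
move=> pG pH u; rewrite -mxtrace_rank1 qform_scalem mulrC -mxtraceZ scalemxAl.
apply: mxtrace_loewner => //.
- by rewrite trmx_mul trmxK.
- by rewrite linearZ /= invmx_sym // (proj1 pH).
move=> v; rewrite qform_scalem qformE bform_row_col [dotv v u]dotvC.
by rewrite -expr2 dotv_cauchy_inv.
Qed.

Lemma bfgs_sym A G u : A^T = A -> G^T = G -> (bfgs A G u)^T = bfgs A G u.
Proof.
move=> sA sG; rewrite /bfgs linearD linearB !linearZ /= !trmx_mul !trmxK sA sG.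
by rewrite !mulmxA.
Qed.

Lemma qform_bfgs A G u v : A^T = A -> G^T = G ->
  qform (bfgs A G u) v = qform G v - bform G v u ^+ 2 / qform G u
                         + bform A v u ^+ 2 / qform A u.
Proof.
move=> sA sG; rewrite /bfgs qformE !bformm -qformE.
have aux B : B^T = B -> bform (B *m u *m u^T *m B) v v = bform B v u ^+ 2.
  move=> sB; have -> : B *m u *m u^T *m B = (B *m u) *m (B *m u)^T.
    by rewrite trmx_mul sB !mulmxA.
  by rewrite bform_row_col [dotv (B *m u) v]dotvC -expr2.
by rewrite !aux // ![_^-1 * _]mulrC.
Qed.

(* Both deflated forms qform X v - bform X v u ^+ 2 / qform X u (X = A, G) are
   invariant under v |-> v - t u; t is chosen so that v - t u is G-orthogonal
   to u. *)
Lemma bfgs_loewner A G u c : posdef A -> posdef G -> u != 0 -> 1 <= c ->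
  loewner_le A (c *: G) -> loewner_le A (c *: bfgs A G u).
Proof.
move=> pA pG u0 c1 AG v; have [sA A0] := pA; have [sG G0] := pG.
have c0 : 0 < c by apply: lt_le_trans c1.
have Au := A0 _ u0; have Gu := G0 _ u0.
rewrite qform_scalem qform_bfgs //.
set t := bform G v u / qform G u.
have := AG (v - t *: u); rewrite qform_scalem !qformE !bformv.
rewrite (bformC u v sA) (bformC u v sG) -!qformE => h.
have hG : qform G v - bform G v u ^+ 2 / qform G u =
    qform G v + - (t * bform G v u) + (- (t * bform G v u) - t * - (t * qform G u)).
  by rewrite /t; field; rewrite gt_eqF.
have hA : qform A v - bform A v u ^+ 2 / qform A u <=
    qform A v + - (t * bform A v u) + (- (t * bform A v u) - t * - (t * qform A u)).
  rewrite -subr_ge0.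
  have -> : qform A v + - (t * bform A v u)
      + (- (t * bform A v u) - t * - (t * qform A u))
      - (qform A v - bform A v u ^+ 2 / qform A u) =
      (t * qform A u - bform A v u) ^+ 2 / qform A u.
    by field; rewrite gt_eqF.
  by rewrite divr_ge0 ?sqr_ge0 // ltW.
(* The restored rank-one term enters the left side with factor 1 and the right side with factor c,
   which is where c >= 1 matters. *)
have : 0 <= bform A v u ^+ 2 / qform A u by rewrite divr_ge0 ?sqr_ge0 // ltW.
rewrite hG mulrDr; move: (bform A v u ^+ 2 / qform A u) hA h => z hA h z0.
rewrite -[qform A v](subrK z); apply: lerD; last by rewrite ler_peMl.
exact: le_trans hA h.
Qed.

(** The added rank-one term contributes exactly 1, because |A u|^2_{A^-1} = |u|^2_A. *)
Lemma mxtrace_bfgs A G u : posdef A -> posdef G -> u != 0 ->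
  \tr (invmx A *m bfgs A G u) =
  \tr (invmx A *m G) - qform (invmx A) (G *m u) / qform G u + 1.
Proof.
move=> pA pG u0; have [sA A0] := pA; have [sG G0] := pG.
have Au := A0 _ u0.
have aux B : B^T = B -> \tr (invmx A *m (B *m u *m u^T *m B)) =
    qform (invmx A) (B *m u).
  move=> sB; have -> : B *m u *m u^T *m B = (B *m u) *m (B *m u)^T.
    by rewrite trmx_mul sB !mulmxA.
  by rewrite mxtrace_mulC mxtrace_rank1.
rewrite /bfgs mulmxDr mulmxBr -!scalemxAr mxtraceD [\tr (_ - _)]raddfB /=.
rewrite !mxtraceZ !aux //.
rewrite qform_inv_mul // mulVf ?gt_eqF //.
by rewrite [_^-1 * _]mulrC.
Qed.

(* qform N is the squared norm for which N^-1 D is self-adjoint: a bound on its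
   numerical radius bounds its operator norm, by polarization. *)
Lemma loewner_sq N D q : posdef N -> D^T = D -> 0 < q ->
  loewner_le D (q *: N) -> loewner_le (- D) (q *: N) ->
  forall v, qform (invmx N) (D *m v) <= q ^+ 2 * qform N v.
Proof.
move=> pN sD q0 h1 h2 v; have [sN _] := pN.
(* With X = |D v|^2_{N^-1}, this w makes both D(v, w) and q |w|^2_N equal to X / q. Adding the
   bounds at v + w and v - w then gives 4 X / q <= 2 q |v|^2_N + 2 X / q. *)
have [w wE] : exists w, w = q^-1 *: (invmx N *m (D *m v)) by eexists.
have := h1 (v + w); have := h2 (v - w).
rewrite !qform_scalem !qformE !bform_oppm !bformv.
rewrite (bformC w v sN) (bformC w v sD) -!qformE.
have NE : qform N w = q^-1 ^+ 2 * qform (invmx N) (D *m v).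
  by rewrite wE qform_inv // !qformE !bformv mulrA expr2.
have DE : bform D v w = q^-1 * qform (invmx N) (D *m v).
  by rewrite wE bformZr bformC // qform_inv // /bform /qform mulmxVv // dotvC
    dotv_mull sD.
have cancel : q * (q^-1 ^+ 2 * qform (invmx N) (D *m v)) =
  q^-1 * qform (invmx N) (D *m v) by field; rewrite gt_eqF.
move=> k1 k2.
have : q^-1 * qform (invmx N) (D *m v) <= q * qform N v.
  by move: k1 k2; rewrite !mulrDr NE cancel DE; lra.
by rewrite mulrC ler_pdivrMr // mulrAC expr2.
Qed.

End BilinearForms.

(** * Contraction of the trace potential by the greedy update *)

Section GreedyUpdate.
Variables (R : realType) (d : nat).
Implicit Types (A G : 'M[R]_d) (u : 'cV[R]_d) (mu L : R).

Lemma posdef1 : posdef (1%:M : 'M[R]_d).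
Proof. by split=> [|u u0]; rewrite ?trmx1 // qformE bform1 dotv_gt0. Qed.

(** By duality the update lowers the trace by at least rho - 1, where rho is the greedy ratio.
    Maximality of rho gives G_jj - A_jj <= (rho - 1) A_jj <= (rho - 1) L; summing over j and using
    A^-1 <= mu^-1 I bounds the potential by d L (rho - 1) / mu. *)
Lemma mxtrace_greedy A G u mu L : 0 < mu -> 0 < L -> A^T = A ->
  (forall v, mu * dotv v v <= qform A v) -> (forall v, qform A v <= L * dotv v v) ->
  G^T = G -> loewner_le A G -> is_greedy_dir A G u ->
  \tr (invmx A *m bfgs A G u) - d%:R <=
  (1 - mu / (d%:R * L)) * (\tr (invmx A *m G) - d%:R).
Proof.
move=> mu0 L0 sA Amu AL sG AG [[k uk] gr].
have d0 : (0 < d)%N by case: d k {uk gr} => [|//] [].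
have pA : posdef A.
  by split=> // v v0; apply: lt_le_trans (Amu v); rewrite mulr_gt0 ?dotv_gt0.
have pG : posdef G.
  by apply: (posdef_loewner ltr01 pA) => //; rewrite scale1r.
have u0 : u != 0 by rewrite uk ebasis_neq0.
rewrite mxtrace_bfgs //.
have Au := proj2 pA _ u0; have Gu := proj2 pG _ u0.
set rho := qform G u / qform A u in gr.
have rhoE : rho <= qform (invmx A) (G *m u) / qform G u.
  rewrite /rho ler_pdivrMr // mulrAC ler_pdivlMr // -expr2 mulrC.
  exact: (dotv_cauchy_inv (G *m u) u pA).
have tr1 : \tr (invmx A *m G) - d%:R = \tr (invmx A *m (G - A)).
  by rewrite mulmxBr mulVmx ?posdef_unit // [RHS]raddfB /= mxtrace1.
have pGA : psd (G - A).
  split=> [|v]; first by rewrite linearB /= sA sG.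
  by rewrite qformE bform_subm subr_ge0 AG.
have tr2 : \tr (invmx A *m G) - d%:R <= mu^-1 * \tr (G - A).
  rewrite tr1 -mxtraceZ -{2}[G - A]mul1mx scalemxAl.
  apply: mxtrace_loewner => //; first exact: invmx_sym.
    by rewrite linearZ /= trmx1.
  rewrite -invmx1; apply: loewner_inv pA posdef1 _ => v.
  by rewrite qformE bform1 qform_scalem -ler_pdivrMl ?invr_gt0 // invrK.
have eA j : qform A (ebasis R j) <= L.
  by rewrite (le_trans (AL _)) // -bform1 -qformE qform_ebasis mxE eqxx mulr1.
have eA0 j := proj2 pA _ (ebasis_neq0 R j).
have rho1 : 1 <= rho by rewrite ler_pdivlMr // mul1r AG.
have tr3 : \tr (G - A) <= d%:R * L * (rho - 1).
  rewrite /mxtrace -mulrA -[X in X%:R * _]card_ord mulr_natl -sumr_const.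
  apply: ler_sum => j _; rewrite -qform_ebasis qformE bform_subm -!qformE.
  have := gr j; rewrite -/rho ler_pdivrMr // => h.
  have : (rho - 1) * qform A (ebasis R j) <= (rho - 1) * L.
    by rewrite ler_wpM2l ?subr_ge0.
  by lra.
have dR : (0 : R) < d%:R by rewrite ltr0n.
have : mu / (d%:R * L) * (\tr (invmx A *m G) - d%:R) <= rho - 1.
  have -> : rho - 1 = mu / (d%:R * L) * (mu^-1 * (d%:R * L * (rho - 1))).
    by field; rewrite !gt_eqF.
  rewrite ler_pM2l ?divr_gt0 ?mulr_gt0 // (le_trans tr2) //.
  by rewrite ler_pM2l ?invr_gt0.
by lra.
Qed.

End GreedyUpdate.

(** * Integrals and derivatives along segments *)

Section Curves.
Variables (R : realType) (d : nat).
Implicit Types (x s u v : 'cV[R]_d).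

Lemma is_derive_line (W : normedModType R) (F : 'cV[R]_d -> W) x s (t : R) :
  differentiable F (x + t *: s) ->
  is_derive t 1 (fun t => F (x + t *: s)) ('d F (x + t *: s) s).
Proof.
move=> dF.
have dl : is_diff t (fun t : R => x + t *: s) (fun h => h *: s).
  have := @is_diffD _ _ _ (cst x) (fun t : R => t *: s) (cst 0) (fun h => h *: s) t.
  by move=> /(_ _ _)/is_diff_eq; apply; apply/funext => h; rewrite /= add0r.
have dc : is_diff t (F \o (fun t : R => x + t *: s))
    ('d F (x + t *: s) \o (fun h => h *: s)).
  by apply: is_diff_comp.
split; first by apply: diff_derivable; apply: ex_diff.
by rewrite deriveE; [rewrite diff_val /= scale1r|apply: ex_diff].
Qed.

Lemma is_derive_dotv (c : R -> 'cV[R]_d) (dc v : 'cV[R]_d) (t : R) :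
  is_derive t 1 c dc -> is_derive t 1 (fun t => dotv (c t) v) (dotv dc v).
Proof.
move=> hc; have dcv : derivable c t 1 by apply: ex_derive.
have dci : forall i j, derivable (fun t => c t i j) t 1 by apply/derivable_mxP.
have dcE i : 'D_1 (fun t => c t i 0) t = dc i 0.
  by rewrite -(@derive_val _ _ _ _ _ _ _ hc) derive_mx // mxE.
have -> : (fun t => dotv (c t) v) = \sum_(i < d) (fun t => c t i 0 * v i 0).
  by apply/funext => r; rewrite dotvE fct_sumE.
rewrite dotvE; apply: is_derive_sum => i.
have di : is_derive t (1 : R) (fun t => c t i 0) (dc i 0).
  by rewrite -dcE; apply: derivableP.
have := @is_deriveM _ _ (fun t => c t i 0) (cst (v i 0)) t 1 (dc i 0) 0 di _.
move=> /(_ _)/is_derive_eq; apply.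
by rewrite scaler0 add0r [_ *: _]mulrC.
Qed.

End Curves.

Section UnitIntegral.
Variable R : realType.
Implicit Types h k : R -> R.

(** The same integral as in the entries of [avg_hessian]. *)
Definition int01 h := Rintegral (@lebesgue_measure R) `[0%R, 1%R]%classic h.

Lemma integrable01 h : continuous h ->
  (@lebesgue_measure R).-integrable `[0%R, 1%R]%classic (EFin \o h).
Proof.
move=> ch; apply: continuous_compact_integrable; first exact: segment_compact.
exact: continuous_subspaceT.
Qed.

Lemma int01D h k : continuous h -> continuous k ->
  int01 (fun t => h t + k t) = int01 h + int01 k.
Proof. by move=> ch ck; apply: RintegralD => //; apply: integrable01. Qed.

Lemma int01Z (a : R) h : continuous h -> int01 (fun t => a * h t) = a * int01 h.
Proof. by move=> ch; apply: RintegralZl => //; apply: integrable01. Qed.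

Lemma le_int01 h k : continuous h -> continuous k ->
  (forall t, 0 <= t <= 1 -> h t <= k t) -> int01 h <= int01 k.
Proof.
by move=> ch ck hk; apply: le_Rintegral => //; apply: integrable01.
Qed.

Lemma int01_cst (a : R) : int01 (fun=> a) = a.
Proof.
rewrite /int01 Rintegral_cst //= lebesgue_measure_itv /= lte_fin ltr01.
by rewrite oppr0 adde0 mulr1.
Qed.

Lemma int01_sum (I : finType) (h : I -> R -> R) : (forall i, continuous (h i)) ->
  int01 (fun t => \sum_i h i t) = \sum_i int01 (h i).
Proof.
(* Continuity of the partial sum is carried through the induction, since [int01D] asks for it. *)
move=> ch; suff H (s : seq I) : int01 (fun t => \sum_(i <- s) h i t) =
  \sum_(i <- s) int01 (h i) /\ continuous (fun t => \sum_(i <- s) h i t).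
  exact: (H (index_enum I)).1.
elim: s => [|i s [IH cs]].
  under eq_fun do rewrite big_nil; rewrite big_nil int01_cst; split=> //.
  exact: cst_continuous.
under eq_fun do rewrite big_cons; rewrite big_cons int01D // IH; split=> //.
by move=> t; apply: continuousD; [apply: ch|apply: cs].
Qed.

Lemma int01_FTC h (F : R -> R) : continuous h ->
  (forall t : R, is_derive t 1 F (h t)) -> int01 h = F 1 - F 0.
Proof.
move=> ch dF; rewrite /int01 /Rintegral (@continuous_FTC2 _ h F) //.
- exact: continuous_subspaceT.
- have cF t : {for t, continuous F}.
    by apply: differentiable_continuous; apply/derivable1_diffP; apply: ex_derive.
  split; first by move=> t _; apply: ex_derive.
  + exact: cvg_at_right_filter (cF 0).
  + exact: cvg_at_left_filter (cF 1).
- by move=> t _; rewrite derive1E derive_val.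
Qed.

Lemma int01_id : int01 id = 1 / 2.
Proof.
have cid : continuous (@id R) by move=> t; apply: cvg_id.
have dF (t : R) : is_derive t 1 (fun t : R => 2^-1 * t ^+ 2) (id t).
  have dX : is_derive t 1 (fun t : R => t ^+ 2) (2%:R * t).
    have := @is_deriveX R R id 2 t 1 1 (is_derive_id t 1).
    by move=> /is_derive_eq; apply; rewrite expr1 /GRing.scale /= mulr1 mulr_natl.
  have := @is_deriveZ R R R (fun t : R => t ^+ 2) 2^-1 t 1 (2%:R * t) dX.
  by move=> /is_derive_eq; apply; rewrite /GRing.scale /= mulrA mulVf // mul1r.
by rewrite (int01_FTC cid dF) expr1n expr0n /= mulr1 mulr0 subr0 mul1r.
Qed.

Lemma continuous_affine (a b : R) : continuous (fun t : R => a + b * t).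
Proof.
move=> t; apply: cvgD; first exact: cvg_cst.
by apply: cvgM; [exact: cvg_cst|exact: cvg_id].
Qed.

Lemma int01_affine (a b : R) : int01 (fun t => a + b * t) = a + b / 2.
Proof.
have cid : continuous (@id R) by move=> t; apply: cvg_id.
rewrite int01D; last 2 first.
- exact: cst_continuous.
- by move=> t; apply: cvgM; [exact: cvg_cst|exact: cvg_id].
by rewrite (int01Z b cid) int01_cst int01_id mul1r.
Qed.

End UnitIntegral.

(** * Symmetry and spectral bounds of the Hessian, and its average over a segment *)

Section Hessian.
Variables (R : realType) (d : nat).
Variables (f : 'cV[R]_d -> R) (g : 'cV[R]_d -> 'cV[R]_d) (H : 'cV[R]_d -> 'M[R]_d).
Variables (mu L M : R).
Hypothesis hs : standing_assumptions f g H mu L M.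
Implicit Types (x y s u v : 'cV[R]_d).

(** The norm here is the sup norm in which differentiability is expressed, not [norm2]. Any constant
    will do, as it is absorbed into an arbitrary epsilon. *)
Lemma dotv_le_norm v : exists2 C : R, 0 <= C & forall u, `|dotv u v| <= C * `|u|.
Proof.
exists (\sum_i `|v i 0|) => [|u]; first by rewrite sumr_ge0.
rewrite dotvE (le_trans (ler_norm_sum _ _ _)) // mulr_suml ler_sum // => i _.
rewrite normrM mulrC ler_wpM2l // [leRHS]/Num.Def.normr /= mx_normrE.
exact: (le_bigmax _ (fun ij => `|u ij.1 ij.2|) (i, 0)).
Qed.

Lemma is_derive_f_line x s (t : R) :
  is_derive t 1 (fun t => f (x + t *: s)) (dotv (g (x + t *: s)) s).
Proof.
by have [df <-] := hs.1 (x + t *: s); apply: is_derive_line.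
Qed.

Lemma is_derive_g_line x s v (t : R) :
  is_derive t 1 (fun t => dotv (g (x + t *: s)) v) (dotv (H (x + t *: s) *m s) v).
Proof.
have [dg <-] := hs.2.1 (x + t *: s); apply: is_derive_dotv.
exact: is_derive_line.
Qed.

Lemma grad_expand x (e : R) : 0 < e -> exists2 r : R, 0 < r &
  forall k, `|k| < r -> `|g (x + k) - (g x + H x *m k)| <= e * `|k|.
Proof.
move=> e0; have [dg dE] := hs.2.1 x.
have /eqaddoP hd := diff_locally dg; have := hd e e0.
move=> /nbhs_normP[r r0 hr]; exists r => // k kr.
have := hr k; rewrite /= sub0r normrN => /(_ kr).
by rewrite !fctE dE [k + x]addrC.
Qed.

(** The mean value theorem, applied in the direction v, turns the double difference of [f] into a
    difference of two gradients near x; both are expanded to first order at x. *)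
Lemma second_difference x u v (e : R) : 0 < e -> exists2 r : R, 0 < r &
  forall h : R, 0 < h -> h < r ->
  `|f (x + h *: u + h *: v) - f (x + h *: u) - f (x + h *: v) + f x
     - h ^+ 2 * dotv (H x *m u) v| <= h ^+ 2 * e.
Proof.
move=> e0; have [C C0 hC] := dotv_le_norm v.
(* Each of the two expansions errs by at most (e / K) h N, and pairing with h v costs the factor C
   h: in total h^2 e (2 C N / K) <= h^2 e. *)
pose N := `|u| + `|v|; pose K := 2 * C * N + 1.
have N0 : 0 <= N by rewrite addr_ge0.
have K0 : 0 < K by rewrite ltr_wpDl // !mulr_ge0.
have [r r0 hr] := grad_expand x (divr_gt0 e0 K0).
exists (r / (N + 1)) => [|h h0]; first by rewrite divr_gt0 // ltr_wpDl.
rewrite ltr_pdivlMr ?ltr_wpDl // => hN.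
pose p := fun t : R => f (x + h *: u + t *: (h *: v)) - f (x + t *: (h *: v)).
pose dp := fun t : R => dotv (g (x + h *: u + t *: (h *: v))) (h *: v)
   - dotv (g (x + t *: (h *: v))) (h *: v).
have pd (t : R) : is_derive t 1 p (dp t).
  by apply: is_deriveB; apply: is_derive_f_line.
have [] := @MVT R p dp 0 1 ltr01 (fun t _ => pd t).
  apply: continuous_subspaceT => t.
  by apply: differentiable_continuous; apply/derivable1_diffP; apply: ex_derive.
move=> t; rewrite in_itv /= => /andP[t0 t1].
rewrite /p /= !scale0r !addr0 !scale1r subr0 mulr1 => pE.
have h0' := ltW h0; have t0' := ltW t0; have t1' := ltW t1.
have small k : `|k| <= h * N ->
    `|g (x + k) - (g x + H x *m k)| <= e / K * (h * N).
  move=> kN; have kr : `|k| < r.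
    rewrite (le_lt_trans kN) // (le_lt_trans _ hN) // ler_wpM2l ?(ltW h0) //.
    by rewrite lerDl.
  by rewrite (le_trans (hr k kr)) // ler_wpM2l // ltW // divr_gt0.
have n1 : `|h *: u + t *: (h *: v)| <= h * N.
  rewrite (le_trans (ler_normD _ _)) // !normrZ (gtr0_norm h0) (gtr0_norm t0).
  by rewrite /N mulrDr lerD // ler_piMl ?mulr_ge0.
have n2 : `|t *: (h *: v)| <= h * N.
  rewrite !normrZ (gtr0_norm h0) (gtr0_norm t0).
  by rewrite /N mulrDr ler_wpDl ?mulr_ge0 // ler_piMl ?mulr_ge0.
have := small _ n1; have := small _ n2.
set e2 := _ - _; move: (erefl e2); rewrite {2}/e2 => E2 s2.
set e1 := _ - _; move: (erefl e1); rewrite {2}/e1 => E1 s1.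
have -> : f (x + h *: u + h *: v) - f (x + h *: u) - f (x + h *: v) + f x
   - h ^+ 2 * dotv (H x *m u) v = h * dotv (e1 - e2) v.
  transitivity (dp t - h ^+ 2 * dotv (H x *m u) v).
    by rewrite -pE; ring.
  rewrite /dp E1 E2 !addrA !dotvZr !dotvBl !dotvDl !mulmxDr !dotvDl.
  by rewrite -!scalemxAr !dotvZl; ring.
rewrite normrM (gtr0_norm h0) expr2 -mulrA ler_pM2l //.
rewrite (le_trans (hC _)) //.
rewrite (@le_trans _ _ (C * (e / K * (h * N) + e / K * (h * N)))) //.
  by rewrite ler_wpM2l // (le_trans (ler_normB _ _)) // lerD.
have -> : C * (e / K * (h * N) + e / K * (h * N)) = h * e * ((2 * C * N) / K).
  by field; rewrite gt_eqF.
by rewrite ler_piMr ?mulr_ge0 ?ltW // ltr_pdivrMr // mul1r /K ltrDl.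
Qed.

(** Schwarz's theorem: the second difference of [f] is symmetric in u and v, and it approximates
    both mixed forms for one common small h. *)
Lemma hess_sym x : (H x)^T = H x.
Proof.
suff S u v : dotv (H x *m u) v = dotv (H x *m v) u.
  apply/matrixP => i j; rewrite mxE -!bform_ebasis /bform.
  by rewrite dotvC S dotvC.
apply/eqP; rewrite -subr_eq0 -normr_le0; apply/ler_addgt0Pl => e e0; rewrite addr0.
have e20 : 0 < e / 2 by rewrite divr_gt0.
have [r1 r10 h1] := second_difference x u v e20.
have [r2 r20 h2] := second_difference x v u e20.
pose h := Num.min r1 r2 / 2.
have m0 : 0 < Num.min r1 r2 by rewrite lt_min r10.
have h0 : 0 < h by rewrite divr_gt0.
have hm : h < Num.min r1 r2 by rewrite /h; lra.
move: hm; rewrite lt_min => /andP[hr1 hr2].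
have := h1 h h0 hr1; have := h2 h h0 hr2.
rewrite [x + h *: v + _]addrAC.
set a := f _; set b := f _; set c := f _; set k := f x => k2 k1.
rewrite -(@ler_pM2l _ (h ^+ 2)) ?exprn_gt0 //.
rewrite -[X in X * `|_|]ger0_norm ?sqr_ge0 // -normrM.
move: k1 k2; rewrite !ler_norml => /andP[? ?] /andP[? ?].
apply/andP; split; lra.
Qed.

(** A single t for each e suffices: it transfers inequalities between finite differences of [g] to
    the Hessian. *)
Lemma hess_secant x u (e : R) : 0 < e -> exists2 t : R, 0 < t &
  `|dotv (g (x + t *: u) - g x) u - t * qform (H x) u| <= t * e.
Proof.
move=> e0; have [C C0 hC] := dotv_le_norm u.
pose K := C * `|u| + 1; have K0 : 0 < K by rewrite ltr_wpDl // mulr_ge0.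
have [r r0 hr] := grad_expand x (divr_gt0 e0 K0).
have N0 : 0 < `|u| + 1 by rewrite ltr_wpDl.
pose t := r / 2 / (`|u| + 1); have t0 : 0 < t by rewrite !divr_gt0.
exists t => //; have tu : `|t *: u| < r.
  rewrite normrZ (gtr0_norm t0) (@lt_trans _ _ (t * (`|u| + 1))) //.
    by rewrite ltr_pM2l // ltrDl.
  by rewrite /t divfK ?gt_eqF //; lra.
have := hr _ tu; set e1 := _ - _; move: (erefl e1); rewrite {2}/e1 => E1 s1.
have -> : dotv (g (x + t *: u) - g x) u - t * qform (H x) u = dotv e1 u.
  rewrite E1 opprD addrA !dotvBl -scalemxAr dotvZl.
  by rewrite /qform [dotv u _]dotvC.
rewrite (le_trans (hC _)) // (@le_trans _ _ (C * (e / K * `|t *: u|))) //.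
  by rewrite ler_wpM2l.
rewrite normrZ (gtr0_norm t0).
have -> : C * (e / K * (t * `|u|)) = t * e * ((C * `|u|) / K).
  by field; rewrite gt_eqF.
by rewrite ler_piMr ?mulr_ge0 ?ltW // ltr_pdivrMr // mul1r /K ltrDl.
Qed.

(** Strong convexity from x to x + t u and back, added up, gives mu t^2 |u|^2 <= t (g(x + t u) -
    g(x)) . u. *)
Lemma hess_lower x u : mu * dotv u u <= qform (H x) u.
Proof.
apply/ler_addgt0Pr => e e0; have [t t0 ht] := hess_secant x u e0.
have [_ [_ [sc _]]] := hs.
have := sc x (x + t *: u); have := sc (x + t *: u) x.
rewrite -[x - _]opprB [x + _ - x]addrC addKr !norm2_sqr.
rewrite !dotvNr !dotvNl !dotvZr !dotvZl opprK => h1 h2.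
rewrite -(ler_pM2l t0) mulrDr -(ler_pM2l t0).
move: ht; rewrite ler_norml dotvBl => /andP[_ h3].
have : t * (dotv (g (x + t *: u)) u - dotv (g x) u - t * qform (H x) u)
  <= t * (t * e) by rewrite ler_pM2l.
by move: h1 h2; lra.
Qed.

(** By Cauchy-Schwarz and the Lipschitz bound, (g(x + t u) - g(x)) . u <= t L |u|^2; compare with
    the secant estimate. *)
Lemma hess_upper x u : qform (H x) u <= L * dotv u u.
Proof.
apply/ler_addgt0Pr => e e0; have [t t0 ht] := hess_secant x u e0.
have [_ [_ [_ [lip _]]]] := hs.
have := lip (x + t *: u) x.
rewrite [x + _ - x]addrC addKr => h1.
have cs : dotv (g (x + t *: u) - g x) u <= t * (L * dotv u u).
  set w := g _ - _ in h1 *.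
  have n0 v : 0 <= norm2 v by apply: sqrtr_ge0.
  have nt : norm2 (t *: u) = t * norm2 u.
    apply/eqP; rewrite -(@eqrXn2 _ 2) ?mulr_ge0 ?n0 ?(ltW t0) //.
    by rewrite exprMn !norm2_sqr dotvZl dotvZr mulrA expr2.
  rewrite nt in h1.
  have : dotv w u <= norm2 w * norm2 u.
    have := bform_cauchy w u (posdef_psd (posdef1 R d)).
    rewrite bform1 !qformE !bform1 -!norm2_sqr -exprMn => h2.
    have := mulr_ge0 (n0 w) (n0 u) => n12.
    rewrite leNgt; apply/negP => h3; have h4 := le_lt_trans n12 h3.
    move: h2; rewrite leNgt => /negP; apply.
    by rewrite ltrXn2r // ltW.
  move=> /le_trans; apply; rewrite -norm2_sqr.
  have -> : t * (L * norm2 u ^+ 2) = L * (t * norm2 u) * norm2 u by ring.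
  by rewrite ler_wpM2r ?n0.
rewrite -(ler_pM2l t0) mulrDr.
by move: ht; rewrite ler_norml => /andP[h _]; lra.
Qed.

Lemma lnormZ z s (a : R) : lnorm H z (a *: s) = `|a| * lnorm H z s.
Proof.
rewrite /lnorm qformE bformZl bformZr mulrA -expr2 sqrtrM ?sqr_ge0 //.
by rewrite sqrtr_sqr.
Qed.

(** The local norm is fixed at x, while the comparison point w stays free so that it can be an
    endpoint or be averaged over the segment. *)
Lemma ssc_line x s w u (a b : R) :
  qform (H (x + b *: s)) u <=
  qform (H (x + a *: s)) u + M * `|b - a| * lnorm H x s * qform (H w) u.
Proof.
have [_ [_ [_ [_ ssc]]]] := hs.
have := ssc (x + a *: s) (x + b *: s) x w u.
have -> : x + b *: s - (x + a *: s) = (b - a) *: s.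
  by rewrite opprD addrACA subrr add0r scalerBl.
rewrite lnormZ qform_scalem !qformE bform_subm.
by rewrite lerBlDl !mulrA.
Qed.

(** Strong self-concordance in both directions, with comparison point x, makes the form Lipschitz in
    t. This supplies the continuity needed to integrate the Hessian. *)
Lemma qform_line_continuous x s u :
  continuous (fun t : R => qform (H (x + t *: s)) u).
Proof.
move=> t; apply/cvgrPdist_le => e e0.
pose c := M * lnorm H x s * qform (H x) u.
pose K := `|c| + 1.
have K0 : 0 < K by rewrite ltr_wpDl.
near=> t'.
have tt : `|t - t'| <= e / K.
  by near: t'; apply: cvgr_dist_le; rewrite ?divr_gt0 //; apply: cvg_id.
have h : c * `|t - t'| <= e.
  rewrite (@le_trans _ _ (K * (e / K))) //; last first.
    by rewrite mulrC divfK // gt_eqF.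
  rewrite (@le_trans _ _ (K * `|t - t'|)) ?ler_wpM2l ?ler_wpM2r ?(ltW K0) //.
  by rewrite /K (le_trans (ler_norm _)) // lerDl.
have := ssc_line x s x u t t'; have := ssc_line x s x u t' t.
rewrite [`|t' - t|]distrC ler_norml => h1 h2.
by move: h; rewrite /c; apply: contraTT; rewrite negb_and -!ltNge => /orP[]; lra.
Unshelve. all: by end_near.
Qed.

Lemma bform_line_continuous x s u v :
  continuous (fun t : R => bform (H (x + t *: s)) u v).
Proof.
have -> : (fun t : R => bform (H (x + t *: s)) u v) =
    (fun t => 2^-1 * (qform (H (x + t *: s)) (u + v)
      + (- qform (H (x + t *: s)) u + - qform (H (x + t *: s)) v))).
  apply/funext => t; rewrite !qformE !bformv (bformC v u (hess_sym _)).
  by field.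
have c w := @qform_line_continuous x s w.
move=> t; apply: cvgM; first exact: cvg_cst.
apply: cvgD; first exact: c.
by apply: cvgD; apply: cvgN; apply: c.
Qed.

Lemma hess_line_continuous x s i j : continuous (fun t : R => H (x + t *: s) i j).
Proof.
have -> : (fun t : R => H (x + t *: s) i j) =
    (fun t => bform (H (x + t *: s)) (ebasis R i) (ebasis R j)).
  by apply/funext => t; rewrite bform_ebasis.
exact: bform_line_continuous.
Qed.

Lemma bform_avg_hessian x s u v :
  bform (avg_hessian H x s) u v = int01 (fun t => bform (H (x + t *: s)) u v).
Proof.
have E A : bform A u v = \sum_(ij : 'I_d * 'I_d) (u ij.1 0 * v ij.2 0) * A ij.1 ij.2.
  rewrite -(pair_bigA _ (fun i j => u i 0 * v j 0 * A i j)) /=.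
  rewrite /bform dotvE; apply: eq_bigr => i _.
  by rewrite mxE mulr_sumr; apply: eq_bigr => j _; ring.
under eq_fun do rewrite E.
rewrite E int01_sum => [|ij t].
  apply: eq_bigr => ij _; rewrite mxE int01Z //.
  exact: hess_line_continuous.
by apply: cvgM; [exact: cvg_cst|exact: hess_line_continuous].
Qed.

Lemma avg_hessian_sym x s : (avg_hessian H x s)^T = avg_hessian H x s.
Proof.
apply/matrixP => i j; rewrite !mxE; apply: eq_Rintegral => t _.
by rewrite -[in LHS]hess_sym mxE.
Qed.

(** The secant equation: the fundamental theorem of calculus for t -> g(x + t s) . v, for each v. *)
Lemma avg_hessian_mul x s : avg_hessian H x s *m s = g (x + s) - g x.
Proof.
suff E v : dotv (avg_hessian H x s *m s) v = dotv (g (x + s) - g x) v.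
  apply/matrixP => i j; rewrite ord1.
  by have := E (ebasis R i); rewrite !dotv_ebasis.
have dF (t : R) : is_derive t 1 (fun t : R => dotv (g (x + t *: s)) v)
    (bform (H (x + t *: s)) v s).
  by rewrite /bform dotvC; apply: is_derive_g_line.
rewrite dotvC -/(bform _ v s) bform_avg_hessian.
rewrite (int01_FTC (@bform_line_continuous x s v s) dF).
by rewrite scale1r scale0r addr0 dotvBl.
Qed.

(** * Two-sided comparison of the averaged Hessian with the endpoint Hessians *)

Section Sandwich.
Variables (x s : 'cV[R]_d).
Let r := lnorm H x s.
Let J := avg_hessian H x s.

Let q u (t : R) := qform (H (x + t *: s)) u.
Let q0 u : q u 0 = qform (H x) u. Proof. by rewrite /q scale0r addr0. Qed.
Let q1 u : q u 1 = qform (H (x + s)) u. Proof. by rewrite /q scale1r. Qed.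

Lemma avg_hessian_le_start : loewner_le J ((1 + M * r / 2) *: H x).
Proof.
move=> u; rewrite qform_scalem [qform J u]bform_avg_hessian.
have -> : (1 + M * r / 2) * qform (H x) u =
    qform (H x) u + (M * r * qform (H x) u) / 2 by ring.
rewrite -int01_affine; apply: le_int01 => [||t /andP[t0 t1]].
- exact: qform_line_continuous.
- exact: continuous_affine.
have := ssc_line x s x u 0 t; rewrite subr0 ger0_norm // -/(q u 0) q0.
by rewrite -/r -qformE; lra.
Qed.

Lemma avg_hessian_le_end : loewner_le J ((1 + M * r / 2) *: H (x + s)).
Proof.
move=> u; rewrite qform_scalem [qform J u]bform_avg_hessian.
(* Seen from the endpoint t = 1 the weight is M r (1 - t), written in the affine form that
   [int01_affine] integrates. *)
have -> : (1 + M * r / 2) * qform (H (x + s)) u =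
    (qform (H (x + s)) u + M * r * qform (H (x + s)) u)
    + (- (M * r * qform (H (x + s)) u)) / 2 by field.
rewrite -int01_affine; apply: le_int01 => [||t /andP[t0 t1]].
- exact: qform_line_continuous.
- exact: continuous_affine.
have := ssc_line x s (x + s) u 1 t.
rewrite distrC ger0_norm ?subr_ge0 // -/(q u 1) q1.
by rewrite -/r -qformE; lra.
Qed.

(* The comparison point of self-concordance is arbitrary: averaging it over the
   segment too turns H w into J. *)
Let average_bound (a b u0 : R) u :
  (forall w t, 0 <= t <= 1 -> u0 <= q u t + (a + b * t) * qform (H w) u) ->
  u0 <= (1 + (a + b / 2)) * qform J u.
Proof.
move=> hw.
have qJ : int01 (q u) = qform J u by rewrite [RHS]bform_avg_hessian.
have h w : u0 - qform J u <= (a + b / 2) * qform (H w) u.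
  rewrite lerBlDl -[u0]int01_cst.
  have -> : qform J u + (a + b / 2) * qform (H w) u = int01 (fun t =>
      q u t + (a * qform (H w) u + b * qform (H w) u * t)).
    rewrite int01D; [|exact: qform_line_continuous|exact: continuous_affine].
    by rewrite int01_affine qJ; ring.
  apply: le_int01 => [||t t01]; first exact: cst_continuous.
    move=> t; apply: cvgD; first exact: qform_line_continuous.
    exact: continuous_affine.
  by have := hw w t t01; rewrite mulrDl; lra.
have : u0 - qform J u <= (a + b / 2) * qform J u.
  rewrite -{2}qJ -int01Z; last exact: qform_line_continuous.
  rewrite -[_ - _]int01_cst; apply: le_int01 => [||t t01].
  - exact: cst_continuous.
  - by move=> t; apply: cvgM; [exact: cvg_cst|exact: qform_line_continuous].
  - exact: h.
by lra.
Qed.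

Lemma avg_hessian_ge_start : loewner_le (H x) ((1 + M * r / 2) *: J).
Proof.
move=> u; rewrite qform_scalem.
have -> : 1 + M * r / 2 = 1 + (0 + M * r / 2) by rewrite add0r.
apply: average_bound => w t /andP[t0 t1].
have := ssc_line x s w u t 0; rewrite sub0r normrN ger0_norm // -/(q u 0) q0.
by rewrite -/r -/(q u t); lra.
Qed.

Lemma avg_hessian_ge_end : loewner_le (H (x + s)) ((1 + M * r / 2) *: J).
Proof.
move=> u; rewrite qform_scalem.
have -> : 1 + M * r / 2 = 1 + (M * r + - (M * r) / 2) by field.
apply: average_bound => w t /andP[t0 t1].
have := ssc_line x s w u t 1; rewrite ger0_norm ?subr_ge0 // -/(q u 1) q1.
by rewrite -/r -/(q u t); lra.
Qed.

End Sandwich.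
End Hessian.

(** * One iteration *)

Lemma mxtrace_ge_dim (R : realType) d (A G : 'M[R]_d) : posdef A -> G^T = G ->
  loewner_le A G -> d%:R <= \tr (invmx A *m G).
Proof.
move=> pA sG AG; rewrite -mxtrace1 -(mulVmx (posdef_unit pA)) -subr_ge0.
rewrite -[_ - _]raddfB /= -mulmxBr mxtrace_psd_mul_ge0 //.
  exact/posdef_psd/posdef_inv.
split=> [|u]; first by rewrite linearB /= sG (proj1 pA).
by rewrite qformE bform_subm subr_ge0 AG.
Qed.

(** With m0 = |s|^2_J, m1 = |s|^2_G, m2 = |G s|^2_{J^-1}, the right side is the drop of tr (J^-1 G)
    under the BFGS update and the fraction on the left is theta^2. If m0 = m1, the two differ by the
    square (m2 - m1)^2 / (m1 m2); the term (c - 1) c pays for having only m0 <= c m1. *)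
Lemma bfgs_gain (R : realType) (m0 m1 m2 c : R) : 0 < m1 -> 1 <= c ->
  m0 <= c * m1 -> m1 <= c * m2 ->
  (m2 - 2 * m1 + m0) / m2 - (c - 1) * c <= m2 / m1 - 1.
Proof.
move=> m10 c1 h0 h2; have c0 : 0 < c by lra.
have m20 : 0 < m2 by rewrite -(pmulr_rgt0 _ c0); lra.
have e1 : (m2 - 2 * m1 + m0) / m2 <= (m2 - 2 * m1 + c * m1) / m2.
  by rewrite ler_pM2r ?invr_gt0 //; lra.
have e2 : (c - 1) * (m1 / m2) <= (c - 1) * c.
  by rewrite ler_wpM2l ?subr_ge0 // ler_pdivrMr.
have e3 : 0 <= (m2 - m1) ^+ 2 / (m1 * m2).
  by rewrite divr_ge0 ?sqr_ge0 // ltW // mulr_gt0.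
have : m2 / m1 - 1 = (m2 - 2 * m1 + c * m1) / m2 - (c - 1) * (m1 / m2)
    + (m2 - m1) ^+ 2 / (m1 * m2).
  by field; rewrite !gt_eqF.
by lra.
Qed.

Section Step.
Variables (R : realType) (d : nat).
Variables (H0 H1 J G : 'M[R]_d) (g0 g1 s u : 'cV[R]_d) (c mu L : R).
Hypotheses (pH0 : posdef H0) (pH1 : posdef H1) (pJ : posdef J) (sG : G^T = G).
Hypotheses (c1 : 1 <= c) (JH0 : loewner_le J (c *: H0)) (JH1 : loewner_le J (c *: H1))
  (H0J : loewner_le H0 (c *: J)) (H1J : loewner_le H1 (c *: J)) (H0G : loewner_le H0 G).
Hypotheses (Gs : G *m s = - g0) (Js : J *m s = g1 - g0) (g00 : g0 != 0).

Let Ghat := c ^+ 2 *: bfgs J G s.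
Let tau0 := \tr (invmx H0 *m G).
Let theta2 := qform (invmx J) g1 / qform (invmx J) g0.

Let c0 : 0 < c. Proof. by apply: lt_le_trans c1. Qed.

Let pG : posdef G.
Proof. by apply: (posdef_loewner ltr01 pH0) => //; rewrite scale1r. Qed.

Let JG : loewner_le J (c *: G).
Proof.
by move=> v; rewrite (le_trans (JH0 v)) // !qform_scalem ler_wpM2l ?(ltW c0).
Qed.

Let s0 : s != 0.
Proof.
by apply: contraNneq g00 => s0; rewrite -oppr_eq0 -Gs s0 mulmx0.
Qed.

Let JGbar : loewner_le J (c *: bfgs J G s).
Proof. exact: bfgs_loewner. Qed.

Let pGbar : posdef (bfgs J G s).
Proof.
by apply: (posdef_loewner c0 pJ _ JGbar); rewrite bfgs_sym ?(proj1 pJ).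
Qed.

Let pGhat : posdef Ghat.
Proof. by apply: posdef_scale pGbar; rewrite exprn_gt0. Qed.

(** The reason for the scaling by c^2: one factor passes from [H1] to [J], the other from [J] to its
    BFGS update. *)
Let H1Ghat : loewner_le H1 Ghat.
Proof.
move=> v; rewrite (le_trans (H1J v)) // /Ghat !qform_scalem expr2 -mulrA.
by rewrite ler_wpM2l ?(ltW c0) // -qform_scalem.
Qed.

Lemma step_loewner w : w != 0 ->
  (bfgs H1 Ghat w)^T = bfgs H1 Ghat w /\ loewner_le H1 (bfgs H1 Ghat w).
Proof.
move=> w0; split; first by rewrite bfgs_sym ?(proj1 pH1) ?(proj1 pGhat).
by rewrite -[X in loewner_le _ X]scale1r; apply: bfgs_loewner; rewrite ?scale1r.
Qed.

Lemma step_theta_ge0 : 0 <= theta2.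
Proof.
by have [_ p] := posdef_psd (posdef_inv pJ); rewrite divr_ge0.
Qed.

(** One factor c replaces H1^-1 by J^-1 at [g1], the other replaces J^-1 by H0^-1 at [g0]. *)
Lemma step_decrement :
  qform (invmx H1) g1 <= c ^+ 2 * theta2 * qform (invmx H0) g0.
Proof.
have p0 : 0 < qform (invmx J) g0 by apply: (proj2 (posdef_inv pJ)).
have := loewner_inv pH1 pJ JH1 g1; have := loewner_inv pJ pH0 H0J g0.
rewrite !qform_scalem => h0 h1; rewrite (le_trans h1) //.
have -> : c * qform (invmx J) g1 = c * theta2 * qform (invmx J) g0.
  by rewrite /theta2 -mulrA divfK // gt_eqF.
have -> : c ^+ 2 * theta2 * qform (invmx H0) g0 =
  c * theta2 * (c * qform (invmx H0) g0) by ring.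
by rewrite ler_wpM2l // mulr_ge0 ?step_theta_ge0 // ltW.
Qed.

(** Since g1 = J s - G s, the operator D = J^-1 - G^-1 sends G s = - g0 to - J^-1 g1. So theta is
    bounded by the norm of D relative to J^-1: G <= c tau0 J bounds D from above, J <= c G from
    below, and [loewner_sq] combines the two. *)
Lemma step_theta_le q : 0 < q -> c - 1 <= q -> 1 - (c * tau0)^-1 <= q ->
  0 < tau0 -> theta2 <= q ^+ 2.
Proof.
move=> q0 cq tq t0; have iJ := posdef_inv pJ.
have p0 : 0 < qform (invmx J) g0 by apply: (proj2 iJ).
have GJ : loewner_le G ((tau0 * c) *: J).
  move=> v; rewrite (le_trans (loewner_trace (posdef_psd pG) pH0 v)) //.
  rewrite !qform_scalem -mulrA ler_pM2l // -qform_scalem; exact: H0J.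
have h1 := loewner_inv pJ pG GJ; have h2 := loewner_inv pG pJ JG.
have JN v : 0 <= qform (invmx J) v by apply: (proj2 (posdef_psd iJ)).
have tc : 0 < tau0 * c by rewrite mulr_gt0.
rewrite /theta2 ler_pdivrMr //.
have := @loewner_sq _ _ (invmx J) (invmx J - invmx G) q iJ _ q0 _ _ (G *m s).
rewrite invmxK mulmxBl (mulVmxv s pG).
have -> : invmx J *m (G *m s) - s = invmx J *m (- g1).
  rewrite -[X in _ - X](mulVmxv s pJ) -mulmxBr Gs Js opprB.
  by rewrite addKr.
rewrite -qform_inv // Gs !qformE !bformv !opprK; apply.
- by rewrite linearB /= !invmx_sym // (proj1 pJ).
- move=> v; rewrite qform_scalem qformE bform_subm -!qformE.
  have := h1 v; rewrite qform_scalem => h.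
  have : (tau0 * c)^-1 * qform (invmx J) v <= qform (invmx G) v.
    by rewrite ler_pdivrMl.
  have := ler_wpM2r (JN v) tq; rewrite [c * tau0]mulrC.
  by rewrite mulrBl mul1r; lra.
- move=> v; rewrite qform_scalem qformE bform_oppm bform_subm -!qformE opprB.
  have := h2 v; rewrite qform_scalem => h.
  by have := ler_wpM2r (JN v) cq; rewrite mulrBl mul1r; lra.
Qed.

Lemma step_trace_ge : d%:R <= \tr (invmx H1 *m Ghat).
Proof. by apply: mxtrace_ge_dim => //; case: pGhat. Qed.

(** The factor c^4 collects c for passing from H1^-1 to J^-1, c for passing from J^-1 to H0^-1, and
    c^2 from the scaling. *)
Lemma step_trace_le :
  \tr (invmx H1 *m Ghat) <= c ^+ 4 * (tau0 + (c - 1)) - theta2.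
Proof.
have [sJ _] := pJ; have [sH0 _] := pH0; have [sH1 _] := pH1.
have t1 : \tr (invmx H1 *m bfgs J G s) <= c * \tr (invmx J *m bfgs J G s).
  rewrite -mxtraceZ scalemxAl; apply: mxtrace_loewner (posdef_psd pGbar).
  - exact: invmx_sym.
  - by rewrite linearZ /= invmx_sym.
  - exact: loewner_inv.
have t2 : \tr (invmx J *m G) <= c * tau0.
  rewrite -mxtraceZ scalemxAl; apply: mxtrace_loewner (posdef_psd pG).
  - exact: invmx_sym.
  - by rewrite linearZ /= invmx_sym.
  - exact: loewner_inv.
pose m0 := qform J s; pose m1 := qform G s; pose m2 := qform (invmx J) (G *m s).
have m00 : 0 < m0 by apply: (proj2 pJ).
have m10 : 0 < m1 by apply: (proj2 pG).
have m01 : m0 <= c * m1 by have := JG s; rewrite qform_scalem.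
have m12 : m1 <= c * m2.
  have h : m1 ^+ 2 <= m0 * m2 := dotv_cauchy_inv (G *m s) s pJ.
  have m20 : 0 <= m2 by apply: (proj2 (posdef_psd (posdef_inv pJ))).
  rewrite -(ler_pM2l m10) -expr2 (le_trans h) // mulrCA mulrA.
  by rewrite ler_wpM2r.
have thE : theta2 = (m2 - 2 * m1 + m0) / m2.
  rewrite /theta2; have -> : g1 = J *m s - G *m s by rewrite Js Gs opprK subrK.
  have -> : qform (invmx J) g0 = m2 by rewrite /m2 Gs !qformE !bformv opprK.
  congr (_ / _); rewrite qformE !bformv -!qformE (qform_inv_mul s pJ).
  rewrite (bformC (G *m s) _ (invmx_sym sJ)) /bform dotv_mull sJ mulmxVv //.
  by rewrite -/(qform G s) -/(qform (invmx J) (G *m s)) -/m0 -/m1 -/m2; ring.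
have := bfgs_gain m10 c1 m01 m12; rewrite -thE => gain.
have t3 : \tr (invmx J *m bfgs J G s) <= c * (tau0 + (c - 1)) - theta2.
  by rewrite mxtrace_bfgs // -/m1 -/m2; move: gain t2; lra.
have th0 := step_theta_ge0.
rewrite /Ghat -scalemxAr mxtraceZ.
have h1 : c ^+ 2 * \tr (invmx H1 *m bfgs J G s) <=
  c ^+ 2 * (c * (c * (tau0 + (c - 1)) - theta2)).
  rewrite ler_wpM2l ?sqr_ge0 // (le_trans t1) // ler_wpM2l //; exact: ltW.
rewrite (le_trans h1) //.
(* [theta2] is subtracted, so its factor c^3 >= 1 may be dropped. *)
have : theta2 <= c ^+ 3 * theta2 by rewrite ler_peMl // exprn_ege1.
have -> : c ^+ 2 * (c * (c * (tau0 + (c - 1)) - theta2)) =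
  c ^+ 4 * (tau0 + (c - 1)) - c ^+ 3 * theta2 by ring.
by lra.
Qed.

Lemma step_greedy : 0 < mu -> 0 < L ->
  (forall v, mu * dotv v v <= qform H1 v) -> (forall v, qform H1 v <= L * dotv v v) ->
  is_greedy_dir H1 Ghat u ->
  \tr (invmx H1 *m bfgs H1 Ghat u) - d%:R <=
  (1 - mu / (d%:R * L)) * (\tr (invmx H1 *m Ghat) - d%:R).
Proof.
move=> mu0 L0 h1 h2 gr; apply: mxtrace_greedy => //; first exact: (proj1 pH1).
exact: (proj1 pGhat).
Qed.

End Step.

(** * The scalar recursion *)

Lemma prod_le_mean (R : realType) (t : nat) (a : nat -> R) (S : R) : (0 < t)%N ->
  (forall i, 0 <= a i) -> \sum_(i < t) a i <= S ->
  \prod_(i < t) a i <= (S / t%:R) ^+ t.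
Proof.
move=> t0 a0 aS.
have := (@leif_AGM R 'I_t xpredT (fun i => a i) (fun i _ => a0 i)).1.
rewrite card_ord => h; apply: le_trans h _.
rewrite lerXn2r ?nnegrE ?divr_ge0 ?sumr_ge0 ?ler0n //.
  by rewrite (le_trans _ aS) // sumr_ge0.
by rewrite ler_wpM2r ?invr_ge0.
Qed.

(* Here dl t = M lambda_t, tau t = tr (H_t^-1 G_t), th t = theta_t^2 and Y t is
   the trace after the BFGS update and the scaling, before the greedy update. *)
Section Recursion.
Variables (R : realType) (k D : R) (dl tau th c Y : nat -> R).
Hypotheses (k0 : 0 < k) (k1 : k <= 1) (D1 : 1 <= D).
Hypotheses (dl0 : forall t, 0 <= dl t) (th0 : forall t, 0 <= th t)
  (c1 : forall t, 1 <= c t) (cdl : forall t, c t <= 1 + dl t / 2)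
  (tauD : forall t, D <= tau t) (YD : forall t, D <= Y t).
Hypothesis dlS : forall t, dl t.+1 ^+ 2 <= c t ^+ 2 * th t * dl t ^+ 2.
Hypothesis th_le : forall t q, 0 < q -> c t - 1 <= q -> 1 - (c t * tau t)^-1 <= q ->
  th t <= q ^+ 2.
Hypothesis tauS : forall t, tau t.+1 - D <= (1 - k) * (Y t - D).
Hypothesis Yle : forall t, Y t <= c t ^+ 4 * (tau t + (c t - 1)) - th t.
Hypotheses (dl_init : dl 0%N <= 3 / 80 * k) (tau_init : tau 0%N <= k^-1).

Let w := 1 - k / 2.
Let w0 : 0 < w. Proof. by rewrite /w; move: k0 k1; lra. Qed.

Lemma one_step t : dl t <= 3 / 80 * k -> tau t <= 6 / 5 * k^-1 ->
  dl t.+1 <= (1 - 3 / 4 * k) * dl t /\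
  Y t <= tau t + 18 / 5 * (dl t / k) - th t.
Proof.
move=> hd ht; have [kp kl] := conj k0 k1.
have := c1 t; have := cdl t; set e := c t - 1 => ce1 ce0.
have e0 : 0 <= e by rewrite /e; lra.
have ed : e <= dl t / 2 by rewrite /e; lra.
have cE : c t = 1 + e by rewrite /e; ring.
have tau1 : 1 <= tau t by apply: le_trans (tauD t).
have ek : e <= 3 / 160 * k by lra.
split.
  (* As c <= 163/160 and tau <= (6/5) / k, the product c tau is at most 1.2225 / k, below 1 / (0.81
     k). The margin between 81/100 and 3/4 absorbs the factor c in c q. *)
  pose q := 1 - 81 / 100 * k.
  have q0 : 0 < q by rewrite /q; lra.
  have ctau : c t * tau t <= (81 / 100 * k)^-1.
    rewrite (@le_trans _ _ (163 / 160 * (6 / 5 * k^-1))) //.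
      by apply: ler_pM => //; rewrite ?cE; lra.
    by rewrite invfM mulrA ler_pM2r ?invr_gt0 //; lra.
  have ct0 : 0 < c t * tau t by rewrite mulr_gt0 //; lra.
  have thq : th t <= q ^+ 2.
    apply: th_le => //; first by rewrite -/e /q; lra.
    rewrite /q lerD2l lerN2 -[leLHS]invrK lef_pV2 // posrE ?invr_gt0 //.
    by lra.
  have : dl t.+1 ^+ 2 <= (c t * q * dl t) ^+ 2.
    rewrite (le_trans (dlS t)) // !exprMn ler_wpM2r ?sqr_ge0 //.
    by rewrite ler_wpM2l ?sqr_ge0.
  have cq0 : 0 <= c t * q by apply: mulr_ge0; lra.
  rewrite ler_sqr ?nnegrE ?(mulr_ge0 cq0) // => /le_trans; apply.
  rewrite ler_wpM2r // cE /q.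
  have : 0 <= e * (81 / 100 * k) by rewrite mulr_ge0 //; lra.
  by lra.
rewrite (le_trans (Yle t)) // lerD2r -/e cE.
(* For e <= 3/160 the terms of order at least 2 add less than 0.12 e to 4 e. *)
have h4 : (1 + e) ^+ 4 <= 1 + 103 / 25 * e.
  have e2 : e ^+ 2 <= 3 / 160 * e.
    by rewrite expr2 ler_wpM2r //; lra.
  have e3 : e ^+ 3 <= 3 / 160 * e ^+ 2.
    by rewrite [leLHS]exprS ler_wpM2r ?sqr_ge0 //; lra.
  have e4 : e ^+ 4 <= 3 / 160 * e ^+ 3.
    by rewrite [leLHS]exprS ler_wpM2r ?exprn_ge0 //; lra.
  have -> : (1 + e) ^+ 4 = 1 + 4 * e + 6 * e ^+ 2 + 4 * e ^+ 3 + e ^+ 4 by ring.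
  by lra.
have te : 0 <= tau t + e by lra.
rewrite (@le_trans _ _ ((1 + 103 / 25 * e) * (tau t + e))) ?ler_wpM2r //.
(* Every error term is compared with e tau, using tau >= 1: the total is below (26/5) e tau, and e
   tau <= (3/5) dl / k, which stays within the 18/5 claimed. *)
have h5 : e * e <= 3 / 160 * (e * tau t).
  rewrite mulrCA ler_wpM2l // (@le_trans _ _ (3 / 160)) //; lra.
have h6 : e <= e * tau t by rewrite ler_peMr.
have h7 : e * tau t <= dl t / 2 * (6 / 5 * k^-1) by apply: ler_pM => //; lra.
by lra.
Qed.

(* 24 / 5 is chosen so that 3 / 4 * (24 / 5), the decrease of the dl term, equals
   the error 18 / 5 in one_step; likewise 72 / 5 below, where only the excess
   3 / 4 - 1 / 2 over the rate of w is available. *)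
Lemma stability t : dl t <= 3 / 80 * k /\
  tau t + 24 / 5 * (dl t / k ^+ 2) <= 6 / 5 * k^-1.
Proof.
have b0 s : 0 <= dl s / k ^+ 2 by rewrite divr_ge0 // sqr_ge0.
elim: t => [|t [IH1 IH2]].
  (* Initially the dl term is at most (24/5) (3/80) / k = 0.18 / k, which fits in the gap between 1
     / k and (6/5) / k. *)
  split=> //; have : dl 0%N / k ^+ 2 <= 3 / 80 * k^-1.
    have -> : 3 / 80 * k^-1 = (3 / 80 * k) / k ^+ 2 by field; rewrite gt_eqF.
    by rewrite ler_wpM2r ?invr_ge0 ?sqr_ge0.
  have : 0 < k^-1 by rewrite invr_gt0.
  by have := tau_init; lra.
have ht : tau t <= 6 / 5 * k^-1 by have := b0 t; move: IH2; lra.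
have [h1 h2] := one_step IH1 ht.
have kp := k0; have kl := k1; have := dl0 t => d0.
split.
  rewrite (le_trans h1) // (le_trans _ IH1) // ler_piMl //; lra.
have h3 : tau t.+1 <= Y t.
  have := tauS t; have YD0 : 0 <= Y t - D by rewrite subr_ge0.
  have : (1 - k) * (Y t - D) <= Y t - D by rewrite ler_piMl //; lra.
  by lra.
have h4 : dl t.+1 / k ^+ 2 <= dl t / k ^+ 2 - 3 / 4 * (dl t / k).
  have -> : dl t / k ^+ 2 - 3 / 4 * (dl t / k) = (1 - 3 / 4 * k) * dl t / k ^+ 2.
    by field; rewrite gt_eqF.
  by rewrite ler_wpM2r ?invr_ge0 ?sqr_ge0.
by have := th0 t; lra.
Qed.

(** The left side does not increase with t. The rate 1 - k of the greedy update is relaxed to w, so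
    that tau - D plus the dl term contracts by w after giving up [th t]; dividing by w^t makes the
    estimates telescope. *)
Lemma weighted_sum t :
  \sum_(i < t) (w ^- i * th i)
  + w ^- t * (tau t - D + 72 / 5 * (dl t / k ^+ 2)) <= 2 * k^-1.
Proof.
have kp := k0; have kl := k1.
have ki : 1 <= k^-1 by rewrite invf_ge1.
elim: t => [|t IH].
  (* The starting value is at most (1 + (72/5) (3/80)) / k = 1.54 / k. *)
  rewrite big_ord0 expr0 invr1 mul1r add0r.
  have : dl 0%N / k ^+ 2 <= 3 / 80 * k^-1.
    have -> : 3 / 80 * k^-1 = (3 / 80 * k) / k ^+ 2 by field; rewrite gt_eqF.
    by rewrite ler_wpM2r ?invr_ge0 ?sqr_ge0.
  by have := D1; have := tau_init; lra.
rewrite big_ord_recr /= -addrA (le_trans _ IH) // lerD2l.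
have [s1 s2] := stability t; have d0 := dl0 t.
have b0 : 0 <= dl t / k ^+ 2 by rewrite divr_ge0 // sqr_ge0.
have ht : tau t <= 6 / 5 * k^-1 by move: s2; lra.
have [h1 h2] := one_step s1 ht.
have -> : w ^- t.+1 = w ^- t * w^-1 by rewrite exprSr invfM mulrC.
rewrite -mulrA -mulrDr ler_wpM2l ?invr_ge0 ?exprn_ge0 ?(ltW w0) //.
rewrite -lerBrDl ler_pdivrMl //.
have h4 : dl t.+1 / k ^+ 2 <= dl t / k ^+ 2 - 3 / 4 * (dl t / k).
  have -> : dl t / k ^+ 2 - 3 / 4 * (dl t / k) = (1 - 3 / 4 * k) * dl t / k ^+ 2.
    by field; rewrite gt_eqF.
  by rewrite ler_wpM2r ?invr_ge0 ?sqr_ge0.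
have a0 : 0 <= dl t / k by rewrite divr_ge0 // ltW.
have h5 : w * (dl t / k ^+ 2) = dl t / k ^+ 2 - dl t / k / 2.
  by rewrite /w; field; rewrite gt_eqF.
have h6 : w * (dl t / k) <= dl t / k by rewrite ler_piMl // /w; lra.
have h7 : tau t.+1 - D <= w * (Y t - D).
  rewrite (le_trans (tauS t)) // ler_wpM2r ?subr_ge0 // /w; lra.
have h8 : w * (Y t - D) <= w * (tau t + 18 / 5 * (dl t / k) - th t - D).
  by rewrite ler_wpM2l ?(ltW w0) // lerD2r.
move: h4 h5 h6 h7 h8; lra.
Qed.

(** The crude bound c <= 2 is enough: the resulting 4^t turns the 2 of [weighted_sum] into the 8 of
    the final estimate. *)
Lemma dl_prod t : dl t ^+ 2 <= 4 ^+ t * \prod_(i < t) th i * dl 0%N ^+ 2.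
Proof.
elim: t => [|t IH]; first by rewrite big_ord0 expr0 !mul1r.
have [s1 s2] := stability t.
have ct : c t <= 2 by have := cdl t; have := k1; move: s1; lra.
have ct0 : 0 <= c t by have := c1 t; lra.
rewrite (le_trans (dlS t)) // big_ord_recr /= [4 ^+ t.+1]exprS.
have -> : 4 * 4 ^+ t * (\prod_(i < t) th i * th t) * dl 0%N ^+ 2 =
   4 * th t * (4 ^+ t * \prod_(i < t) th i * dl 0%N ^+ 2) by ring.
apply: ler_pM => //; rewrite ?mulr_ge0 ?sqr_ge0 //.
rewrite ler_wpM2r //; have -> : (4 : R) = 2 ^+ 2 by ring.
by rewrite lerXn2r ?nnegrE.
Qed.

(** AM-GM bounds the product of the w^-i th_i by (2 / (k t))^t, and the weights multiply to
    w^-C(t,2) because 0 + ... + (t - 1) = C(t,2). *)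
Lemma dl_superlinear t : (0 < t)%N ->
  dl t ^+ 2 <= w ^+ 'C(t, 2) * (8 / (t%:R * k)) ^+ t * dl 0%N ^+ 2.
Proof.
move=> t0; have kp := k0; have tR : (0 : R) < t%:R by rewrite ltr0n.
rewrite (le_trans (dl_prod t)) // ler_wpM2r ?sqr_ge0 //.
have wth i : 0 <= w ^- i * th i.
  by rewrite mulr_ge0 // invr_ge0 exprn_ge0 // ltW.
have S2 : \sum_(i < t) (w ^- i * th i) <= 2 * k^-1.
  rewrite (le_trans _ (weighted_sum t)) // lerDl mulr_ge0 //.
    by rewrite invr_ge0 exprn_ge0 // ltW.
  by rewrite addr_ge0 ?subr_ge0 // mulr_ge0 // divr_ge0 ?sqr_ge0.
have := prod_le_mean t0 wth S2.
rewrite big_split /= => h.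
have wE : \prod_(i < t) w ^- i = w ^- 'C(t, 2).
  rewrite prodfV; congr (_^-1).
  by rewrite prodrXr; congr (_ ^+ _); rewrite -(big_mkord xpredT id) bin2_sum.
rewrite wE ler_pdivrMl ?exprn_gt0 // in h.
have -> : w ^+ 'C(t, 2) * (8 / (t%:R * k)) ^+ t =
  4 ^+ t * (w ^+ 'C(t, 2) * (2 / k / t%:R) ^+ t).
  rewrite mulrCA -exprMn; congr (_ * _ ^+ _); field.
  by rewrite !gt_eqF.
by rewrite ler_wpM2l ?exprn_ge0.
Qed.

End Recursion.

(** * Convergence *)

Section Convergence.
Variables (R : realType) (d : nat).
Variables (f : 'cV[R]_d -> R) (g : 'cV[R]_d -> 'cV[R]_d) (H : 'cV[R]_d -> 'M[R]_d).
Variables (mu L M : R) (x : nat -> 'cV[R]_d) (G : nat -> 'M[R]_d).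
Hypotheses (mu0 : 0 < mu) (muL : mu <= L) (M0 : 0 < M).
Hypothesis hs : standing_assumptions f g H mu L M.
Hypothesis hb : sharpened_bfgs g H L M x G.
Hypothesis gn0 : forall t, g (x t) != 0.

Let s t := x t.+1 - x t.
Let r t := lnorm H (x t) (s t).
Let c t := 1 + M * r t / 2.
Let J t := avg_hessian H (x t) (s t).
Let Ghat t := c t ^+ 2 *: bfgs (J t) (G t) (s t).
Let lam t := newton_decr g H (x t).
Let tau t := \tr (invmx (H (x t)) *m G t).
Let th t := qform (invmx (J t)) (g (x t.+1)) / qform (invmx (J t)) (g (x t)).
Let Y t := \tr (invmx (H (x t.+1)) *m Ghat t).
Let kappa := mu / (d%:R * L).

Let L0 : 0 < L. Proof. exact: lt_le_trans muL. Qed.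

(** In dimension 0 every vector is zero, whereas the gradient at x_0 is not. *)
Let d0 : (0 < d)%N.
Proof.
case: (posnP d) => // dE; case/negP: (gn0 0%N); apply/eqP/matrixP => i.
by have := ltn_ord i; rewrite {2}dE.
Qed.

Let dR : (0 : R) < d%:R. Proof. by rewrite ltr0n. Qed.

Let kappa_gt0 : 0 < kappa.
Proof. by rewrite divr_gt0 // mulr_gt0. Qed.

Let kappa_le1 : kappa <= 1.
Proof.
rewrite ler_pdivrMr ?mulr_gt0 // mul1r (le_trans muL) // ler_peMl ?(ltW L0) //.
by rewrite ler1n.
Qed.

Lemma rate_bounds : 0 < kappa /\ kappa <= 1. Proof. by []. Qed.

Let pH y : posdef (H y).
Proof.
split=> [|u u0]; first exact: hess_sym hs _.
by apply: lt_le_trans (hess_lower hs y u); rewrite mulr_gt0 // dotv_gt0.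
Qed.

Let r_ge0 t : 0 <= r t. Proof. exact: sqrtr_ge0. Qed.

Let c1 t : 1 <= c t.
Proof. by rewrite lerDl divr_ge0 // mulr_ge0 // ltW. Qed.

Let c0 t : 0 < c t. Proof. exact: lt_le_trans (c1 t). Qed.

Let xS t : x t.+1 = x t + s t. Proof. by rewrite /s addrC subrK. Qed.

Let JH0 t : loewner_le (J t) (c t *: H (x t)).
Proof. exact: avg_hessian_le_start hs _ _. Qed.
Let JH1 t : loewner_le (J t) (c t *: H (x t.+1)).
Proof. by rewrite xS; exact: avg_hessian_le_end hs _ _. Qed.
Let H0J t : loewner_le (H (x t)) (c t *: J t).
Proof. exact: avg_hessian_ge_start hs _ _. Qed.
Let H1J t : loewner_le (H (x t.+1)) (c t *: J t).
Proof. by rewrite xS; exact: avg_hessian_ge_end hs _ _. Qed.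

Let pJ t : posdef (J t).
Proof. by apply: posdef_loewner (H0J t) => //; apply: avg_hessian_sym hs _ _. Qed.

Let Js t : J t *m s t = g (x t.+1) - g (x t).
Proof. by rewrite /J (avg_hessian_mul hs) -xS. Qed.

(** Positive definiteness is a premise because this is used inside the induction that establishes
    it. *)
Let Gs_of t : posdef (G t) -> G t *m s t = - g (x t).
Proof.
move=> pG; rewrite /s (hb.2 t).1 addrC addKr mulmxN mulmxVv //.
Qed.

Let posdef_G t : (G t)^T = G t -> loewner_le (H (x t)) (G t) -> posdef (G t).
Proof.
by move=> sG HG; apply: (posdef_loewner ltr01 (pH (x t))); rewrite ?scale1r.
Qed.

(** It starts from H <= L I, and each iteration restores it by [step_loewner]. *)
Let G_inv t : (G t)^T = G t /\ loewner_le (H (x t)) (G t).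
Proof.
elim: t => [|t [sG HG]].
  rewrite hb.1 tr_scalar_mx; split=> // u.
  by rewrite -scalemx1 qform_scalem (qformE 1%:M) bform1; apply: hess_upper hs _ _.
have pG := posdef_G sG HG.
have [_ [u [gr ->]]] := hb.2 t.
have u0 : u != 0 by case: gr => [[i ->] _]; exact: ebasis_neq0.
exact: (step_loewner (pH (x t)) (pH _) (pJ t) sG (c1 t) (JH0 t) (H1J t) HG
  (Gs_of pG) (gn0 t) u0).
Qed.

Let sG t := (G_inv t).1.
Let HG t := (G_inv t).2.
Let pG t : posdef (G t). Proof. exact: posdef_G. Qed.
Let Gs t : G t *m s t = - g (x t). Proof. exact: Gs_of. Qed.

Let lam_ge0 t : 0 <= lam t. Proof. exact: sqrtr_ge0. Qed.

Let lam_sqr t : lam t ^+ 2 = qform (invmx (H (x t))) (g (x t)).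
Proof.
by rewrite sqr_sqrtr //; have [_ p] := posdef_psd (posdef_inv (pH (x t))); apply: p.
Qed.

(** The invariant H <= G is used twice: |s|^2_H <= |s|^2_G = |g|^2_{G^-1} <= |g|^2_{H^-1}. *)
Let r_le_lam t : r t <= lam t.
Proof.
rewrite ler_wsqrtr // (le_trans (HG t _)) //.
have -> : qform (G t) (s t) = qform (invmx (G t)) (g (x t)).
  by rewrite -(qform_inv_mul (s t) (pG t)) Gs !qformE !bformv opprK.
have := loewner_inv (pG t) (pH (x t)) (c := 1) _ (g (x t)).
by rewrite !scale1r; apply; exact: HG.
Qed.

Let c_le t : c t <= 1 + M * lam t / 2.
Proof. by rewrite lerD2l ler_pM2r // ler_pM2l. Qed.

Let tau_ge t : d%:R <= tau t.
Proof. exact: mxtrace_ge_dim. Qed.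

(** G_0 = L I and H^-1 <= mu^-1 I, so the trace is at most d L / mu. *)
Let tau_init : tau 0%N <= kappa^-1.
Proof.
rewrite /tau hb.1 -scalemx1 -scalemxAr mulmx1 mxtraceZ.
have : \tr (invmx (H (x 0%N)) *m 1%:M) <= 
      \tr ((mu^-1 *: invmx (1%:M : 'M[R]_d)) *m 1%:M).
  apply: mxtrace_loewner; last exact/posdef_psd/posdef1.
  - by apply: invmx_sym; case: (pH (x 0%N)).
  - by rewrite invmx1 linearZ /= trmx1.
  apply: loewner_inv (pH _) (posdef1 R d) _ => v.
  rewrite qformE bform1 qform_scalem -ler_pdivrMl ?invr_gt0 // invrK.
  exact: hess_lower hs _ _.
rewrite !mulmx1 invmx1 mxtraceZ mxtrace1 => h.
have -> : kappa^-1 = L * (mu^-1 * d%:R).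
  by rewrite /kappa; field; rewrite !gt_eqF.
by rewrite ler_pM2l.
Qed.

(** The estimate is squared so that all exponents are natural numbers. *)
Lemma newton_decr_superlinear t : (0 < t)%N ->
  lam 0%N <= (ln 2 / 20) * mu / (d%:R * M * L) ->
  lam t ^+ 2 <= (1 - kappa / 2) ^+ 'C(t, 2) * (8 / (t%:R * kappa)) ^+ t * lam 0%N ^+ 2.
Proof.
move=> t0 hl.
(* exp(3/4) = exp(3/32)^8 >= (35/32)^8 > 2. This rational bound turns ln 2 / 20 into the 3/80 of the
   recursion. *)
have ln2 : ln 2 <= 3 / 4 :> R.
  rewrite -ler_expR lnK ?posrE //.
  have e0 : 1 + 3 / 32 <= expR (3 / 32) :> R by apply: expR_ge1Dx.
  have -> : 3 / 4 = 8%:R * (3 / 32) :> R by field.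
  rewrite expRM_natl.
  have := lerXn2r 8 _ _ e0; rewrite !nnegrE expR_ge0 => /(_ _ isT) h.
  apply: le_trans (h _); lra.
have init : M * lam 0%N <= 3 / 80 * kappa.
  rewrite -(ler_pM2l M0) in hl; rewrite (le_trans hl) //.
  have -> : M * (ln 2 / 20 * mu / (d%:R * M * L)) = ln 2 / 20 * kappa.
    by rewrite /kappa; field; rewrite !gt_eqF.
  rewrite ler_pM2r //; lra.
suff : (M * lam t) ^+ 2 <= (1 - kappa / 2) ^+ 'C(t, 2)
    * (8 / (t%:R * kappa)) ^+ t * (M * lam 0%N) ^+ 2.
  by rewrite ![(M * _) ^+ 2]exprMn [leRHS]mulrCA ler_pM2l ?exprn_gt0.
apply: (@dl_superlinear R kappa d%:R (fun t => M * lam t) tau th c Y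
  kappa_gt0 kappa_le1 _ _ _ c1 c_le tau_ge _ _ _ _ _ init tau_init t t0).
- by rewrite ler1n.
- by move=> i; rewrite mulr_ge0 // ltW.
- by move=> i; apply: step_theta_ge0.
- by move=> i; apply: (step_trace_ge (pH (x i)) (pH _) (pJ i) (sG i) (c1 i) (JH0 i)
    (H1J i) (HG i) (Gs i) (gn0 i)).
- move=> i; rewrite ![(M * _) ^+ 2]exprMn [leRHS]mulrCA ler_pM2l ?exprn_gt0 // !lam_sqr.
  exact: (step_decrement _ (pH (x i)) (pH _) (pJ i) (c1 i) (JH1 i) (H0J i) (gn0 i)).
- move=> i q q0 cq tq.
  apply: (step_theta_le (pH (x i)) (pJ i) (sG i) (c1 i) (JH0 i) (H0J i) (HG i)
    (Gs i) (Js i) (gn0 i)) => //.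
  by apply: lt_le_trans (tau_ge i).
- move=> i; rewrite /tau; have [_ [u [gr ->]]] := hb.2 i.
  exact: (step_greedy (pH (x i)) (pH _) (pJ i) (sG i) (c1 i) (JH0 i) (H1J i) (HG i)
    (Gs i) (gn0 i) mu0 L0 (hess_lower hs _) (hess_upper hs _) gr).
- move=> i; exact: (step_trace_le (pH (x i)) (pH _) (pJ i) (sG i) (c1 i) (JH0 i)
    (JH1 i) (H0J i) (HG i) (Gs i) (Js i) (gn0 i)).
Qed.

End Convergence.

Theorem theorem4 (R : realType) (d : nat)
  (f : 'cV[R]_d -> R) (g : 'cV[R]_d -> 'cV[R]_d) (H : 'cV[R]_d -> 'M[R]_d)
  (mu L M : R) (x : nat -> 'cV[R]_d) (G : nat -> 'M[R]_d) :
  0 < mu -> mu <= L -> 0 < M ->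
  standing_assumptions f g H mu L M ->
  sharpened_bfgs g H L M x G ->
  (forall t, g (x t) != 0) ->
  newton_decr g H (x 0%N) <= (ln 2 / 20) * mu / (d%:R * M * L) ->
  forall t : nat, (1 <= t)%N ->
    newton_decr g H (x t) <=
      2 * (1 - mu / (2 * d%:R * L)) `^ (t%:R * (t%:R - 1) / 4)
        * (8 * d%:R * L / (t%:R * mu)) `^ (t%:R / 2)
        * newton_decr g H (x 0%N).
Proof.
move=> mu0 muL M0 hs hb gn0 hl t t0.
have [k0 k1] := rate_bounds mu0 muL gn0.
have := newton_decr_superlinear mu0 muL M0 hs hb gn0 t0 hl.
set kappa := mu / (d%:R * L) in k0 k1 *.
have -> : 1 - mu / (2 * d%:R * L) = 1 - kappa / 2.
  by rewrite /kappa -mulrA invfM mulrCA mulrC.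
have -> : 8 * d%:R * L / (t%:R * mu) = 8 / (t%:R * kappa).
  by rewrite /kappa !invfM !invrK; ring.
set w := 1 - kappa / 2; set b := 8 / _.
have w0 : 0 < w by rewrite /w; lra.
have b0 : 0 < b by rewrite divr_gt0 // mulr_gt0 // ltr0n.
have l0 i : 0 <= newton_decr g H (x i) by apply: sqrtr_ge0.
set W := w `^ _; set B := b `^ _ => h.
have W0 : 0 <= W by apply: powR_ge0.
have B0 : 0 <= B by apply: powR_ge0.
(* Doubling the real exponent t (t - 1) / 4 gives C(t,2), so the squared estimate can be compared
   with the real powers of the claim. *)
have WE : W ^+ 2 = w ^+ 'C(t, 2).
  rewrite -powR_mulrn // -powRrM -powR_mulrn ?(ltW w0) //; congr (_ `^ _).
  have tt : t%:R * (t%:R - 1) = ('C(t, 2))%:R * 2%:R :> R.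
    elim: (t) => [|n IH]; first by rewrite !mul0r.
    by rewrite binS bin1 natrD mulrDl -IH -natr1; ring.
  by rewrite tt; field.
have BE : B ^+ 2 = b ^+ t.
  rewrite -powR_mulrn // -powRrM -powR_mulrn ?(ltW b0) //; congr (_ `^ _).
  by field.
have le1 : newton_decr g H (x t) <= W * B * newton_decr g H (x 0%N).
  by rewrite -ler_sqr ?nnegrE ?mulr_ge0 // !exprMn WE BE.
rewrite (le_trans le1) // -!mulrA ler_peMl ?mulr_ge0 //; lra.
Qed.
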